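(* Let $\mathbf{k}$ be a field and $p\in(0,\infty)$. Let $X$ be a simplicial complex with filtration $f:X\to\mathbb{R}_+$, and let $C^f(X)$ be the associated chain complex of persistence modules. Let $A=\mathbf{k}[\alpha,\infty)$ where $\alpha$ is larger than any value of $f$. Then, for every $n\ge 0$, $H^n(\mathscr{H}om^{\ell^p_c}(C^f(X),A))$ is the dual of the $n$-th persistent Borel–Moore homology of the filtration $f_{\alpha^p}$ on $X$; i.e. it is isomorphic, as a persistence module $\mathbf{R}_+\to\mathbf{Vect}_{\mathbf{k}}$, to $$t\mapsto \mathrm{Hom}_{\mathbf{k}}\big(H_n^{BM}(H_t),\mathbf{k}\big).$$ In particular, the persistent Borel–Moore homology of $f_{\alpha^p}$ can be calculated from the (non-naturally) split natural short exact sequence $$0\to \mathbf{Ext}^1_{\ell^p_c}(H_{n-1}(C^f(X)),A)\to H^n(\mathscr{H}om^{\ell^p_c}(C^f(X), A))\to \mathscr{H}om^{\ell^p_c}(H_n(C^f(X)),A)\to 0.$$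
   Context: $\mathbb{R}_+=\{x\in\mathbb{R}:x\ge 0\}$. A persistence module is a functor $M:\mathbf{R}_+\to\mathbf{Vect}_{\mathbf{k}}$ on the poset category of $\mathbb{R}_+$. $\mathbf{k}[a,\infty)$ is the persistence module equal to $\mathbf{k}$ on $[a,\infty)$ and $0$ elsewhere, with identity maps inside $[a,\infty)$. Internal hom: let $\varphi=\ell^p_c:\mathbb{R}_+^2\to\mathbb{R}_+$, $\ell^p_c(a,b)=(a^p+b^p)^{1/p}$, which is order-preserving, and let $\pi_1,\pi_2:\mathbb{R}_+^2\to\mathbb{R}_+$ be the projections. For order-preserving $h:P\to Q$: $(h^{-1}G)_p=G_{h(p)}$, $(h_*F)_q=\lim_{q\le h(p)}F_p$; and $\mathscr{H}om_{\mathbf{Q}}(M,N)_q=\mathrm{Hom}(M|_{\mathbf{U}_q},N|_{\mathbf{U}_q})$ (natural transformations), $U_q=\{q'\in Q:q\le q'\}$, with restriction maps as structure maps. Then $\mathscr{H}om^{\ell^p_c}(M,N)=\pi_{2*}\mathscr{H}om_{\mathbf{R}_+^2}(\pi_1^{-1}M,\varphi^{-1}N)$. $\mathbf{Ext}^i_{\ell^p_c}(M,N)=H^i(\mathscr{H}om^{\ell^p_c}(Q_\bullet,N))$ for a projective resolution $Q_\bullet\to M$ in the category of persistence modules. For a chain complex $K$, $\mathscr{H}om^{\ell^p_c}(K,A)$ is the cochain complex $n\mapsto\mathscr{H}om^{\ell^p_c}(K_n,A)$ with differentials induced by those of $K$ (up to sign). A filtration of a simplicial complex $X$ is a function $f:X\to\mathbb{R}_+$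 constant on (open) simplices with $f(\sigma)\le f(\tau)$ whenever $\sigma\subset\tau$. Its chain complex is $C^f_m(X)=\bigoplus_{\sigma}\mathbf{k}[f(\sigma),\infty)$ over the $m$-simplices $\sigma$, with boundary induced by the simplicial (cellular) boundary: $(d_m)_a(\sigma_a)=(\partial\sigma)_a$ for $a\ge f(\sigma)$. The function $f_{\alpha^p}:X\to\mathbb{R}_+$ is $f_{\alpha^p}(\sigma)=(\alpha^p-f(\sigma)^p)^{1/p}$. For $t\in\mathbb{R}_+$ put $H_t=f_{\alpha^p}^{-1}[0,t]=X\setminus T_t$, where $T_t=f^{-1}\big[0,\max(0,\alpha^p-t^p)^{1/p}\big)$ is a subcomplex of $X$. The Borel–Moore homology of $H=X\setminus T$ ($T$ a subcomplex) is the relative homology $H_n^{BM}(H)=H_n(X,T;\mathbf{k})$. For $s\le t$ we have $T_t\subseteq T_s$, inducing linear maps $H_n^{BM}(H_t)=H_n(X,T_t)\to H_n(X,T_s)=H_n^{BM}(H_s)$; this contravariant functor on $\mathbf{R}_+$ is the $n$-th persistent Borel–Moore homology of $f_{\alpha^p}$. Applying $\mathrm{Hom}_{\mathbf{k}}(-,\mathbf{k})$ gives a covariant functor $\mathbf{R}_+\to\mathbf{Vect}_{\mathbf{k}}$, its dual. *)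

(* Defs.v *)
From HB Require Import structures.
From mathcomp Require Import all_boot all_order all_algebra.
From mathcomp Require Import finmap.
From mathcomp.multinomials Require Import monalg.
From mathcomp Require Import boolp classical_sets functions reals exp
  interval_inference.

Set Implicit Arguments.
Unset Strict Implicit.
Unset Printing Implicit Defensive.

Import Order.TTheory GRing.Theory Num.Theory.
Local Open Scope quotient_scope.
Local Open Scope fset_scope.
Local Open Scope ring_scope.

Section MkLinear.
Variables (k : fieldType) (U V : lmodType k).

Definition linear_fun (f : U -> V) (fL : linear f) : U -> V := f.

HB.instance Definition _ f (fL : linear f) :=
  GRing.isLinear.Build k U V *:%R (linear_fun fL) fL.

Definition mk_linear f (fL : linear f) : {linear U -> V} := linear_fun fL.

End MkLinear.

Section Submodule.
Variables (k : fieldType) (V : lmodType k).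

Record submod := Submod {
  in_submod :> V -> Prop;
  submod0 : in_submod 0;
  submodD : forall x y, in_submod x -> in_submod y -> in_submod (x + y);
  submodZ : forall (c : k) x, in_submod x -> in_submod (c *: x) }.

Variable S : submod.

Definition submod_pred : {pred V} := fun x => `[< S x >].

Lemma submod_predP x : reflect (S x) (x \in submod_pred).
Proof. exact: asboolP. Qed.

Lemma submod_pred_closed : submod_closed submod_pred.
Proof.
split=> [|c x y /submod_predP Sx /submod_predP Sy]; apply/submod_predP.
  exact: submod0.
by apply: submodD => //; apply: submodZ.
Qed.

HB.instance Definition _ :=
  GRing.isSubmodClosed.Build k V submod_pred submod_pred_closed.

Record submod_type := SubmodType {
  submod_val : V;
  submod_valP : submod_val \in submod_pred }.

HB.instance Definition _ := [isSub for submod_val].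
HB.instance Definition _ := [Choice of submod_type by <:].
HB.instance Definition _ := [SubChoice_isSubLmodule of submod_type by <:].

End Submodule.

Section LinearAlgebra.
Variables (k : fieldType).
Implicit Types (U V W : lmodType k).

Program Definition full_submod V : submod V := @Submod k V (fun=> True) _ _ _.
Solve All Obligations with by [].

Program Definition zero_submod V : submod V :=
  @Submod k V (fun x => x = 0) _ _ _.
Next Obligation. by []. Qed.
Next Obligation. by move=> V x y /= -> ->; rewrite addr0. Qed.
Next Obligation. by move=> V c x /= ->; rewrite scaler0. Qed.

Program Definition ker_submod U V (f : {linear U -> V}) : submod U :=
  @Submod k U (fun x => f x = 0) _ _ _.
Next Obligation. by move=> U V f /=; rewrite linear0. Qed.
Next Obligation. by move=> U V f x y /= fx fy; rewrite linearD fx fy addr0. Qed.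
Next Obligation. by move=> U V f c x /= fx; rewrite linearZ /= fx scaler0. Qed.

Program Definition im_submod U V (f : {linear U -> V}) : submod V :=
  @Submod k V (fun y => exists x, f x = y) _ _ _.
Next Obligation. by move=> U V f; exists 0; rewrite linear0. Qed.
Next Obligation.
by move=> U V f _ _ [x <-] [y <-]; exists (x + y); rewrite linearD.
Qed.
Next Obligation.
by move=> U V f c _ [x <-]; exists (c *: x); rewrite linearZ.
Qed.

Program Definition preim_submod U V (f : {linear U -> V}) (S : submod V) :
  submod U := @Submod k U (fun x => S (f x)) _ _ _.
Next Obligation. by move=> U V f S /=; rewrite linear0; exact: submod0. Qed.
Next Obligation.
by move=> U V f S x y /= Sx Sy; rewrite linearD; exact: submodD.
Qed.
Next Obligation.
by move=> U V f S c x /= Sx; rewrite linearZ; exact: submodZ.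
Qed.

Section SubmodMap.
Variables (U V : lmodType k) (S : submod U) (T : submod V).
Variables (f : {linear U -> V}) (fST : forall x, S x -> T (f x)).

Lemma submod_map_subproof (x : submod_type S) :
  f (\val x) \in submod_pred T.
Proof. by apply/submod_predP/fST/submod_predP/(valP x). Qed.

Definition submod_map_fun (x : submod_type S) : submod_type T :=
  SubmodType (submod_map_subproof x).

Lemma submod_map_linear : linear submod_map_fun.
Proof. by move=> c x y; apply: val_inj; rewrite /= !linearP. Qed.

Definition submod_map : {linear submod_type S -> submod_type T} :=
  mk_linear submod_map_linear.

End SubmodMap.

(* Dependent products of vector spaces.  The alias keeps this structure apart
   from the one that the library puts on non-dependent function types. *)
Section DepProduct.
Variables (I : Type) (V : I -> lmodType k).

Definition dprod := forall i, V i.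

HB.instance Definition _ := Choice.on dprod.

Let add (x y : dprod) : dprod := fun i => x i + y i.
Let opp (x : dprod) : dprod := fun i => - x i.
Let scale (c : k) (x : dprod) : dprod := fun i => c *: x i.

Let addA : associative add.
Proof.
by move=> x y z; apply: functional_extensionality_dep => i; exact: addrA.
Qed.
Let addC : commutative add.
Proof.
by move=> x y; apply: functional_extensionality_dep => i; exact: addrC.
Qed.
Let add0 : left_id (fun=> 0) add.
Proof.
by move=> x; apply: functional_extensionality_dep => i; exact: add0r.
Qed.
Let addN : left_inverse (fun=> 0) opp add.
Proof.
by move=> x; apply: functional_extensionality_dep => i; exact: addNr.
Qed.

HB.instance Definition _ := GRing.isZmodule.Build dprod addA addC add0 addN.

Let scaleA c d x : scale c (scale d x) = scale (c * d) x.
Proof. by apply: functional_extensionality_dep => i; exact: scalerA. Qed.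
Let scale1 : left_id 1 scale.
Proof.
by move=> x; apply: functional_extensionality_dep => i; exact: scale1r.
Qed.
Let scaleDr : right_distributive scale +%R.
Proof.
by move=> c x y; apply: functional_extensionality_dep => i; exact: scalerDr.
Qed.
Let scaleDl x : {morph scale^~ x : c d / c + d}.
Proof.
by move=> c d; apply: functional_extensionality_dep => i; exact: scalerDl.
Qed.

HB.instance Definition _ :=
  GRing.Zmodule_isLmodule.Build k dprod scaleA scale1 scaleDr scaleDl.

End DepProduct.

Lemma dprod_irrelevance (I : Type) (p : pred I) (V : I -> lmodType k)
    (x : forall s : {i | p i}, V (sval s)) i (pi pi' : p i) :
  x (exist _ i pi) = x (exist _ i pi').
Proof. by rewrite (bool_irrelevance pi pi'). Qed.

Section Quotient.
Variables (V : lmodType k) (S : submod V).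

Definition quot_mod := Quotient.quot (submod_pred S).

HB.instance Definition _ := GRing.Zmodule.on quot_mod.

Definition quot_proj_fun (x : V) : quot_mod := \pi_(quot_mod) x.

Lemma quot_projE x y : quot_proj_fun x = quot_proj_fun y <-> S (x - y).
Proof.
split=> [/eqP|Sxy]; first by rewrite -Quotient.idealrBE => /submod_predP.
by apply/eqP; rewrite -Quotient.idealrBE; apply/submod_predP.
Qed.

Lemma quot_projD x y :
  quot_proj_fun (x + y) = quot_proj_fun x + quot_proj_fun y.
Proof. by rewrite /quot_proj_fun !piE. Qed.

Lemma quot_projK (z : quot_mod) : quot_proj_fun (repr z) = z.
Proof. exact: reprK. Qed.

Let scale (c : k) (z : quot_mod) : quot_mod := quot_proj_fun (c *: repr z).

Let scaleE c x : scale c (quot_proj_fun x) = quot_proj_fun (c *: x).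
Proof.
apply/quot_projE; rewrite -scalerBr; apply: submodZ.
by apply/quot_projE; rewrite quot_projK.
Qed.

Let scaleA c d x : scale c (scale d x) = scale (c * d) x.
Proof. by rewrite -[x]quot_projK !scaleE scalerA. Qed.
Let scale1 : left_id 1 scale.
Proof. by move=> x; rewrite -[x]quot_projK scaleE scale1r. Qed.
Let scaleDr : right_distributive scale +%R.
Proof.
move=> c x y; rewrite -[x]quot_projK -[y]quot_projK.
by rewrite -quot_projD !scaleE scalerDr quot_projD.
Qed.
Let scaleDl x : {morph scale^~ x : c d / c + d}.
Proof.
by move=> c d; rewrite -[x]quot_projK !scaleE scalerDl quot_projD.
Qed.

HB.instance Definition _ :=
  GRing.Zmodule_isLmodule.Build k quot_mod scaleA scale1 scaleDr scaleDl.

Lemma quot_proj_linear : linear quot_proj_fun.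
Proof. by move=> c x y; rewrite quot_projD -scaleE. Qed.

Definition quot_proj : {linear V -> quot_mod} := mk_linear quot_proj_linear.

Lemma quot_proj_eq x y : quot_proj x = quot_proj y <-> S (x - y).
Proof. exact: quot_projE. Qed.

Lemma quot_proj_eq0 x : quot_proj x = 0 <-> S x.
Proof. by rewrite -[X in _ = X](linear0 quot_proj) quot_proj_eq subr0. Qed.

Lemma quot_ind (P : quot_mod -> Prop) :
  (forall x, P (quot_proj x)) -> forall z, P z.
Proof. by move=> Ppi z; rewrite -[z]quot_projK; exact: Ppi. Qed.

End Quotient.

Section QuotientMap.
Variables (U V : lmodType k) (S : submod U) (T : submod V).
Variables (f : {linear U -> V}) (fST : forall x, S x -> T (f x)).

Definition quot_map_fun (z : quot_mod S) : quot_mod T :=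
  quot_proj T (f (repr z)).

Lemma quot_map_funE x : quot_map_fun (quot_proj S x) = quot_proj T (f x).
Proof.
apply/quot_proj_eq; rewrite -linearB; apply: fST.
by apply/quot_proj_eq; exact: quot_projK.
Qed.

Lemma quot_map_linear : linear quot_map_fun.
Proof.
move=> c; elim/quot_ind => x; elim/quot_ind => y.
by rewrite -linearP !quot_map_funE !linearP.
Qed.

Definition quot_map : {linear quot_mod S -> quot_mod T} :=
  mk_linear quot_map_linear.

Lemma quot_mapE x : quot_map (quot_proj S x) = quot_proj T (f x).
Proof. exact: quot_map_funE. Qed.

End QuotientMap.

(* Z / (Z \cap B), for subspaces Z and B of V *)
Section Subquotient.

Definition submod_in V (Z B : submod V) : submod (submod_type Z) :=
  preim_submod (\val : {linear submod_type Z -> V}) B.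

Definition subquot V (Z B : submod V) : lmodType k :=
  quot_mod (submod_in Z B).

Variables (U V : lmodType k) (Z B : submod U) (Z' B' : submod V).
Variables (f : {linear U -> V}).
Variables (fZ : forall x, Z x -> Z' (f x)) (fB : forall x, B x -> B' (f x)).

Definition subquot_map : {linear subquot Z B -> subquot Z' B'} :=
  @quot_map _ _ (submod_in Z B) (submod_in Z' B') (submod_map fZ)
    (fun x => @fB (\val x)).

Lemma subquot_mapE x :
  subquot_map (quot_proj _ x) = quot_proj _ (submod_map fZ x).
Proof. exact: quot_mapE. Qed.

End Subquotient.

Program Definition linear_submod U V : submod (U -> V) :=
  @Submod k (U -> V) (fun f => linear f) _ _ _.
Next Obligation. by move=> U V c x y /=; rewrite scaler0 addr0. Qed.
Next Obligation.
move=> U V f g fL gL c x y; rewrite !addrfctE fL gL scalerDr.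
by rewrite addrACA.
Qed.
Next Obligation.
move=> U V c f fL d x y; have cfE z : (c *: f) z = c *: f z by [].
by rewrite !cfE fL scalerDr !scalerA mulrC.
Qed.

Definition Hom U V : lmodType k := submod_type (linear_submod U V).

Definition Hom_app U V (f : Hom U V) : U -> V := \val f.

Lemma Hom_linear U V (f : Hom U V) : linear (Hom_app f).
Proof. by have /submod_predP := valP f. Qed.

HB.instance Definition _ U V (f : Hom U V) :=
  GRing.isLinear.Build k U V *:%R (Hom_app f) (Hom_linear f).

Section HomMap.
Variables (U U' V V' : lmodType k).
Variables (g : {linear U' -> U}) (h : {linear V -> V'}).

Definition pre_post (f : U -> V) : U' -> V' := fun x => h (f (g x)).

Lemma pre_post_linear : linear pre_post.
Proof. by move=> c f1 f2; apply/funext => x; rewrite /pre_post /= linearP. Qed.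

Lemma pre_post_sub f : linear_submod U V f -> linear_submod U' V' (pre_post f).
Proof. by move=> fL c x y; rewrite /pre_post linearP fL linearP. Qed.

Definition Hom_map : {linear Hom U V -> Hom U' V'} :=
  submod_map (f := mk_linear pre_post_linear) pre_post_sub.

End HomMap.

End LinearAlgebra.

Section PersistenceModules.
Variables (k : fieldType).

Section Poset.
Variables (d : Order.disp_t) (P : porderType d).

Record pmod := PMod {
  pm_obj :> P -> lmodType k;
  pm_map : forall s t, (s <= t)%O -> {linear pm_obj s -> pm_obj t};
  pm_map_id : forall s (le_ss : (s <= s)%O) x, pm_map le_ss x = x;
  pm_map_comp : forall r s t (le_rs : (r <= s)%O) (le_st : (s <= t)%O)
    (le_rt : (r <= t)%O) x, pm_map le_st (pm_map le_rs x) = pm_map le_rt x }.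

Record pmor (M N : pmod) := PMor {
  pmor_at :> forall t, {linear M t -> N t};
  pmor_natural : forall s t (le_st : (s <= t)%O) x,
    pmor_at t (pm_map M le_st x) = pm_map N le_st (pmor_at s x) }.

Program Definition pmor_id (M : pmod) : pmor M M :=
  @PMor M M (fun t => idfun) _.
Next Obligation. by []. Qed.

Definition pmod_iso (M N : pmod) : Prop :=
  exists (g : pmor M N) (h : pmor N M),
    (forall t x, h t (g t x) = x) /\ (forall t y, g t (h t y) = y).

Definition short_exact (L M N : pmod) (i : pmor L M) (q : pmor M N) : Prop :=
  [/\ forall t, injective (i t),
      forall t y, q t y = 0 <-> exists x, i t x = y
    & forall t z, exists y, q t y = z].

Definition split_epi (M N : pmod) (q : pmor M N) : Prop :=
  exists s : pmor N M, forall t z, q t (s t z) = z.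

Program Definition zero_pmod : pmod :=
  @PMod (fun=> 'rV[k]_0) (fun _ _ _ => idfun) _ _.
Next Obligation. by []. Qed.
Next Obligation. by []. Qed.

Program Definition zero_pmor : pmor zero_pmod zero_pmod :=
  @PMor zero_pmod zero_pmod (fun=> idfun) _.
Next Obligation. by []. Qed.

(* k[a,oo): the space at s is the subspace of k which is k itself if a <= s
   and 0 otherwise *)
Program Definition interval_submod (a s : P) : submod k^o :=
  @Submod k k^o (fun x => ~~ (a <= s)%O -> x = 0) _ _ _.
Next Obligation. by []. Qed.
Next Obligation.
by move=> a s x y x0 y0 /[dup] /x0 -> /y0 ->; rewrite addr0.
Qed.
Next Obligation. by move=> a s c x x0 /x0 ->; rewrite scaler0. Qed.

Lemma interval_sub (a s t : P) (le_st : (s <= t)%O) (x : k^o) :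
  interval_submod a s x -> interval_submod a t (idfun x).
Proof. by move=> x0 at_; apply/x0/(contra _ at_) => /le_trans; apply. Qed.

Program Definition interval (a : P) : pmod :=
  @PMod (fun s => submod_type (interval_submod a s))
    (fun s t le_st => submod_map (@interval_sub a s t le_st)) _ _.
Next Obligation. by move=> a s le_ss x; apply: val_inj. Qed.
Next Obligation. by move=> *; apply: val_inj. Qed.

Section SubPmod.
Variable M : pmod.

Record subpmod := SubPmod {
  subpm_at :> forall t, submod (M t);
  subpm_stable : forall s t (le_st : (s <= t)%O) x,
    subpm_at s x -> subpm_at t (pm_map M le_st x) }.

Variables Z B : subpmod.

Definition subquot_pmod_map s t (le_st : (s <= t)%O) :
    {linear subquot (Z s) (B s) -> subquot (Z t) (B t)} :=
  subquot_map (@subpm_stable Z s t le_st) (@subpm_stable B s t le_st).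

(* Z / (Z \cap B) *)
Program Definition subquot_pmod : pmod :=
  @PMod (fun t => subquot (Z t) (B t)) subquot_pmod_map _ _.
Next Obligation.
move=> s le_ss; elim/quot_ind => x; rewrite [LHS]subquot_mapE.
congr (quot_proj _ _).
by apply: val_inj; exact: pm_map_id.
Qed.
Next Obligation.
move=> r s t le_rs le_st le_rt; elim/quot_ind => x.
rewrite /subquot_pmod_map (subquot_mapE _ _ x) !subquot_mapE.
congr (quot_proj _ _); apply: val_inj; exact: pm_map_comp.
Qed.

Program Definition full_subpmod : subpmod :=
  @SubPmod (fun t => full_submod (M t)) _.
Next Obligation. by []. Qed.

Program Definition zero_subpmod : subpmod :=
  @SubPmod (fun t => zero_submod (M t)) _.
Next Obligation. by move=> s t le_st x /= ->; rewrite linear0. Qed.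

End SubPmod.

Program Definition ker_subpmod M N (g : pmor M N) : subpmod M :=
  @SubPmod M (fun t => ker_submod (g t)) _.
Next Obligation.
by move=> M N g s t le_st x /= gx; rewrite pmor_natural gx linear0.
Qed.

Program Definition im_subpmod M N (g : pmor M N) : subpmod N :=
  @SubPmod N (fun t => im_submod (g t)) _.
Next Obligation.
move=> M N g s t le_st _ [x <-]; exists (pm_map M le_st x).
exact: pmor_natural.
Qed.

Section SubquotMap.
Variables (M N : pmod) (Z B : subpmod M) (Z' B' : subpmod N) (g : pmor M N).
Hypothesis gZ : forall t x, Z t x -> Z' t (g t x).
Hypothesis gB : forall t x, B t x -> B' t (g t x).

Program Definition subquot_pmor :
    pmor (subquot_pmod Z B) (subquot_pmod Z' B') :=
  @PMor _ _ (fun t => subquot_map (@gZ t) (@gB t)) _.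
Next Obligation.
move=> s t le_st; elim/quot_ind => x.
rewrite /= /subquot_pmod_map !(subquot_mapE _ _ x) !subquot_mapE.
by congr (quot_proj _ _); apply: val_inj; exact: pmor_natural.
Qed.

End SubquotMap.

Record chain_complex := ChainComplex {
  ch_obj :> nat -> pmod;
  ch_d : forall n, pmor (ch_obj n.+1) (ch_obj n);
  ch_dd : forall n t x, ch_d n t (ch_d n.+1 t x) = 0 }.

Record cochain_complex := CochainComplex {
  coch_obj :> nat -> pmod;
  coch_d : forall n, pmor (coch_obj n) (coch_obj n.+1);
  coch_dd : forall n t x, coch_d n.+1 t (coch_d n t x) = 0 }.

Record chain_map (K L : chain_complex) := ChainMap {
  chm_at :> forall n, pmor (K n) (L n);
  chm_comm : forall n t x,
    chm_at n t (ch_d K n t x) = ch_d L n t (chm_at n.+1 t x) }.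

Record cochain_map (K L : cochain_complex) := CochainMap {
  cochm_at :> forall n, pmor (K n) (L n);
  cochm_comm : forall n t x,
    cochm_at n.+1 t (coch_d K n t x) = coch_d L n t (cochm_at n t x) }.

Definition cycles (K : chain_complex) n : subpmod (K n) :=
  match n with
  | 0%N => full_subpmod (K 0%N)
  | m.+1 => ker_subpmod (ch_d K m)
  end.

Definition homology (K : chain_complex) n : pmod :=
  subquot_pmod (cycles K n) (im_subpmod (ch_d K n)).

Definition coboundaries (K : cochain_complex) n : subpmod (K n) :=
  match n with
  | 0%N => zero_subpmod (K 0%N)
  | m.+1 => im_subpmod (coch_d K m)
  end.

Definition cohomology (K : cochain_complex) n : pmod :=
  subquot_pmod (ker_subpmod (coch_d K n)) (coboundaries K n).

Section ChainMapHomology.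
Variables (K L : chain_complex) (F : chain_map K L).

Lemma chain_map_cycles n t x : cycles K n t x -> cycles L n t (F n t x).
Proof. by case: n x => [|n] x //= dx; rewrite -chm_comm dx linear0. Qed.

Lemma chain_map_boundaries n t x :
  im_subpmod (ch_d K n) t x -> im_subpmod (ch_d L n) t (F n t x).
Proof. by case=> y <-; exists (F n.+1 t y); rewrite chm_comm. Qed.

Definition homology_map n : pmor (homology K n) (homology L n) :=
  subquot_pmor (@chain_map_cycles n) (@chain_map_boundaries n).

End ChainMapHomology.

Section CochainMapCohomology.
Variables (K L : cochain_complex) (F : cochain_map K L).

Lemma cochain_map_cocycles n t x :
  ker_subpmod (coch_d K n) t x -> ker_subpmod (coch_d L n) t (F n t x).
Proof. by move=> /= dx; rewrite -cochm_comm dx linear0. Qed.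

Lemma cochain_map_coboundaries n t x :
  coboundaries K n t x -> coboundaries L n t (F n t x).
Proof.
case: n x => [|n] x /=; first by move=> ->; rewrite linear0.
by case=> y <-; exists (F n t y); rewrite cochm_comm.
Qed.

Definition cohomology_map n : pmor (cohomology K n) (cohomology L n) :=
  subquot_pmor (@cochain_map_cocycles n) (@cochain_map_coboundaries n).

End CochainMapCohomology.

(* H_{n-1}(K), where H_{-1} = 0 *)
Definition homology_pred (K : chain_complex) n : pmod :=
  if n is m.+1 then homology K m else zero_pmod.

Definition homology_pred_map K L (F : chain_map K L) n :
    pmor (homology_pred K n) (homology_pred L n) :=
  match n with
  | 0%N => zero_pmor
  | m.+1 => homology_map F m
  end.

Definition projective (M : pmod) : Prop :=
  forall (N N' : pmod) (e : pmor N N') (h : pmor M N'),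
    (forall t y, exists x, e t x = y) ->
    exists h' : pmor M N, forall t x, e t (h' t x) = h t x.

Record projective_resolution (M : pmod) := ProjectiveResolution {
  res_complex :> chain_complex;
  res_aug : pmor (res_complex 0%N) M;
  res_projective : forall n, projective (res_complex n);
  res_aug_surj : forall t y, exists x, res_aug t x = y;
  res_aug_exact : forall t x,
    res_aug t x = 0 <-> exists y, ch_d res_complex 0 t y = x;
  res_exact : forall n t x,
    ch_d res_complex n t x = 0 <-> exists y, ch_d res_complex n.+1 t y = x }.

Definition lifts_to_resolutions (M N : pmod) (Q : projective_resolution M)
    (Q' : projective_resolution N) (g : pmor M N) (G : chain_map Q Q') : Prop :=
  forall t x, res_aug Q' t (G 0%N t x) = g t (res_aug Q t x).

(* Hom_Q(M,N)_q: the natural transformations M|U_q -> N|U_q *)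
Section InternalHom.
Variables (M N : pmod).

Definition upset (q : P) := {q' : P | (q <= q')%O}.

Definition hom_family (q : P) : lmodType k :=
  dprod (fun q' : upset q => Hom (M (sval q')) (N (sval q'))).

Program Definition nat_submod (q : P) : submod (hom_family q) :=
  @Submod k (hom_family q) (fun eta =>
    forall (s t : upset q) (le_st : (sval s <= sval t)%O) x,
      Hom_app (eta t) (pm_map M le_st x) = pm_map N le_st (Hom_app (eta s) x))
    _ _ _.
Next Obligation. by move=> q s t le_st x /=; rewrite linear0. Qed.
Next Obligation.
move=> q e1 e2 e1N e2N s t le_st x.
have addE u y : Hom_app ((e1 + e2) u) y = Hom_app (e1 u) y + Hom_app (e2 u) y.
  by [].
by rewrite !addE e1N e2N linearD.
Qed.
Next Obligation.
move=> q c e eN s t le_st x.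
have scaleE u y : Hom_app ((c *: e) u) y = c *: Hom_app (e u) y by [].
by rewrite !scaleE eN linearZ.
Qed.

Definition upset_incl (q0 q1 : P) (le_q : (q0 <= q1)%O) (q' : upset q1) :
    upset q0 :=
  exist _ (sval q') (le_trans le_q (svalP q')).

Definition hom_restrict_fun (q0 q1 : P) (le_q : (q0 <= q1)%O)
    (eta : hom_family q0) : hom_family q1 :=
  fun q' => eta (upset_incl le_q q').

Lemma hom_restrict_linear q0 q1 le_q : linear (@hom_restrict_fun q0 q1 le_q).
Proof. by []. Qed.

Lemma hom_restrict_nat q0 q1 le_q eta :
  nat_submod q0 eta -> nat_submod q1 (@hom_restrict_fun q0 q1 le_q eta).
Proof.
move=> etaN s t le_st x.
exact: (etaN (upset_incl le_q s) (upset_incl le_q t) le_st x).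
Qed.

Definition ihom_res q0 q1 (le_q : (q0 <= q1)%O) :
    {linear submod_type (nat_submod q0) -> submod_type (nat_submod q1)} :=
  submod_map (f := mk_linear (@hom_restrict_linear q0 q1 le_q))
    (@hom_restrict_nat q0 q1 le_q).

Program Definition ihom : pmod :=
  @PMod (fun q => submod_type (nat_submod q)) ihom_res _ _.
Next Obligation.
move=> q le_qq x; apply: val_inj; apply: functional_extensionality_dep.
case=> s le_qs; rewrite /= /linear_fun.
exact: (@dprod_irrelevance _ _ (fun s => q <= s)%O
  (fun s => Hom (M s) (N s)) (\val x)).
Qed.
Next Obligation.
move=> q0 q1 q2 le01 le12 le02 x; apply: val_inj.
apply: functional_extensionality_dep => -[s le_qs].
exact: (@dprod_irrelevance _ _ (fun s => q0 <= s)%O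
  (fun s => Hom (M s) (N s)) (\val x)).
Qed.

End InternalHom.

Section InternalHomMap.
Variables (M M' N N' : pmod) (g : pmor M' M) (a : pmor N N').

Definition hom_family_map_fun q (eta : hom_family M N q) : hom_family M' N' q :=
  fun q' => Hom_map (g (sval q')) (a (sval q')) (eta q').

Lemma hom_family_map_linear q : linear (@hom_family_map_fun q).
Proof.
move=> c x y; apply: functional_extensionality_dep => q'.
by rewrite /hom_family_map_fun linearP.
Qed.

Lemma hom_family_map_nat q eta :
  nat_submod M N q eta -> nat_submod M' N' q (@hom_family_map_fun q eta).
Proof.
move=> etaN s t le_st x; rewrite /hom_family_map_fun.
rewrite -[LHS]/(a _ (Hom_app (eta t) (g _ (pm_map M' le_st x)))).
by rewrite pmor_natural etaN pmor_natural.
Qed.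

Program Definition ihom_map : pmor (ihom M N) (ihom M' N') :=
  @PMor (ihom M N) (ihom M' N') (fun q =>
    submod_map (f := mk_linear (@hom_family_map_linear q))
      (@hom_family_map_nat q)) _.
Next Obligation. by move=> s t le_st x; apply: val_inj. Qed.

End InternalHomMap.

End Poset.

Section ChangeOfPoset.
Variables (d d' : Order.disp_t) (P : porderType d) (Q : porderType d').
Variables (h : P -> Q).

Section Pullback.
Hypothesis hM : {homo h : s t / (s <= t)%O}.

Program Definition pullback (G : pmod Q) : pmod P :=
  @PMod _ P (fun s => G (h s)) (fun s t le_st => pm_map G (hM le_st)) _ _.
Next Obligation. by move=> G s le_ss x; exact: pm_map_id. Qed.
Next Obligation. by move=> G r s t le_rs le_st le_rt x; exact: pm_map_comp. Qed.

Program Definition pullback_map (G G' : pmod Q) (g : pmor G G') :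
    pmor (pullback G) (pullback G') :=
  @PMor _ _ (pullback G) (pullback G') (fun s => g (h s)) _.
Next Obligation.
by move=> G G' g s t le_st x; exact: (pmor_natural g (hM le_st)).
Qed.

End Pullback.

(* (h_* F)_q: the limit of F over {p | q <= h(p)}, as the space of compatible
   families *)
Section Pushforward.
Variable F : pmod P.

Definition above (q : Q) := {s : P | (q <= h s)%O}.

Definition lim_family (q : Q) : lmodType k :=
  dprod (fun s : above q => F (sval s)).

Program Definition lim_submod (q : Q) : submod (lim_family q) :=
  @Submod k (lim_family q) (fun x =>
    forall (s t : above q) (le_st : (sval s <= sval t)%O),
      pm_map F le_st (x s) = x t) _ _ _.
Next Obligation. by move=> q s t le_st; rewrite linear0. Qed.
Next Obligation.
by move=> q x y xC yC s t le_st; rewrite linearD xC yC.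
Qed.
Next Obligation. by move=> q c x xC s t le_st; rewrite linearZ /= xC. Qed.

Definition above_incl (q0 q1 : Q) (le_q : (q0 <= q1)%O) (s : above q1) :
    above q0 :=
  exist _ (sval s) (le_trans le_q (svalP s)).

Definition lim_restrict_fun (q0 q1 : Q) (le_q : (q0 <= q1)%O)
    (x : lim_family q0) : lim_family q1 :=
  fun s => x (above_incl le_q s).

Lemma lim_restrict_linear q0 q1 le_q : linear (@lim_restrict_fun q0 q1 le_q).
Proof. by []. Qed.

Lemma lim_restrict_compat q0 q1 le_q x :
  lim_submod q0 x -> lim_submod q1 (@lim_restrict_fun q0 q1 le_q x).
Proof.
by move=> xC s t le_st; exact: (xC (above_incl le_q s) (above_incl le_q t)).
Qed.

Program Definition pushforward : pmod Q :=
  @PMod _ Q (fun q => submod_type (lim_submod q))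
    (fun q0 q1 le_q =>
       submod_map (f := mk_linear (@lim_restrict_linear q0 q1 le_q))
         (@lim_restrict_compat q0 q1 le_q)) _ _.
Next Obligation.
move=> q le_qq x; apply: val_inj; apply: functional_extensionality_dep.
case=> s le_qs; rewrite /= /linear_fun.
exact: (@dprod_irrelevance _ _ (fun s => q <= h s)%O F (\val x)).
Qed.
Next Obligation.
move=> q0 q1 q2 le01 le12 le02 x; apply: val_inj.
apply: functional_extensionality_dep => -[s le_qs].
exact: (@dprod_irrelevance _ _ (fun s => q0 <= h s)%O F (\val x)).
Qed.

End Pushforward.

Section PushforwardMap.
Variables (F F' : pmod P) (g : pmor F F').

Definition lim_family_map_fun q (x : lim_family F q) : lim_family F' q :=
  fun s => g (sval s) (x s).

Lemma lim_family_map_linear q : linear (@lim_family_map_fun q).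
Proof.
move=> c x y; apply: functional_extensionality_dep => s.
by rewrite /lim_family_map_fun linearP.
Qed.

Lemma lim_family_map_compat q x :
  lim_submod F q x -> lim_submod F' q (@lim_family_map_fun q x).
Proof.
by move=> xC s t le_st; rewrite /lim_family_map_fun -pmor_natural xC.
Qed.

Program Definition pushforward_map : pmor (pushforward F) (pushforward F') :=
  @PMor _ _ (pushforward F) (pushforward F') (fun q =>
    submod_map (f := mk_linear (@lim_family_map_linear q))
      (@lim_family_map_compat q)) _.
Next Obligation. by move=> s t le_st x; apply: val_inj. Qed.

End PushforwardMap.

End ChangeOfPoset.

(* A contravariant functor on P is a persistence module over the dual poset. *)
Program Definition dual_pmod d (P : porderType d) (M : pmod (P^d)%type) :
    pmod P :=
  @PMod _ P (fun t => Hom (M t) k^o)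
    (fun s t le_st =>
       Hom_map (@pm_map _ _ M t s le_st) (idfun : {linear k^o -> k^o})) _ _.
Next Obligation.
move=> d P M s le_ss f; apply: val_inj; apply/funext => x /=.
by rewrite /linear_fun /pre_post /= pm_map_id.
Qed.
Next Obligation.
move=> d P M r s t le_rs le_st le_rt f; apply: val_inj; apply/funext => x /=.
rewrite /linear_fun /pre_post /=.
by rewrite (@pm_map_comp _ _ M t s r le_st le_rs le_rt).
Qed.

End PersistenceModules.

Section InternalHomLp.
Variables (R : realType) (k : fieldType) (p : {posnum R}).

Local Notation Rp := {nonneg R}.
Local Notation Rp2 := (Rp *p Rp)%type.
Local Notation pm := (pmod k Rp).

Definition lp_norm (x : Rp2) : Rp :=
  ((x.1%:num `^ p%:num + x.2%:num `^ p%:num) `^ (p%:num)^-1)%:nng.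

Lemma lp_norm_homo : {homo lp_norm : x y / (x <= y)%O}.
Proof.
move=> [a b] [a' b'] /andP[/= le_a le_b].
rewrite -[(_ <= _)%O]/(_ `^ _ <= _ `^ _).
by apply: ge0_ler_powR; rewrite ?nnegrE ?invr_ge0 ?addr_ge0 ?powR_ge0 //
  lerD // ge0_ler_powR ?nnegrE.
Qed.

Definition proj1_lp (x : Rp2) : Rp := x.1.
Definition proj2_lp (x : Rp2) : Rp := x.2.

Lemma proj1_lp_homo : {homo proj1_lp : x y / (x <= y)%O}.
Proof. by move=> x y /andP[]. Qed.

Definition ihom_lp (M N : pm) : pm :=
  pushforward proj2_lp
    (ihom (pullback proj1_lp_homo M) (pullback lp_norm_homo N)).

Definition ihom_lp_map (M M' N N' : pm) (g : pmor M' M) (a : pmor N N') :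
    pmor (ihom_lp M N) (ihom_lp M' N') :=
  pushforward_map proj2_lp
    (ihom_map (pullback_map proj1_lp_homo g) (pullback_map lp_norm_homo a)).

Local Notation ev x s u := (Hom_app (\val (\val x s) u)).

Lemma ihom_lp_mapE M M' N N' (g : pmor M' M) (a : pmor N N') t
    (x : ihom_lp M N t) s u y :
  ev (ihom_lp_map g a t x) s u y = a _ (ev x s u (g _ y)).
Proof. by []. Qed.

Lemma ihom_lp_ext M N t (x x' : ihom_lp M N t) :
  (forall s u y, ev x s u y = ev x' s u y) -> x = x'.
Proof.
move=> xx'; apply: val_inj; apply: functional_extensionality_dep => s.
apply: val_inj; apply: functional_extensionality_dep => u.
by apply: val_inj; apply/funext => y; exact: xx'.
Qed.

Program Definition ihom_lp_complex (K : chain_complex k Rp) (N : pm) :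
    cochain_complex k Rp :=
  @CochainComplex _ _ _ (fun n => ihom_lp (K n) N)
    (fun n => ihom_lp_map (ch_d K n) (pmor_id N)) _.
Next Obligation.
move=> K N n t x; apply: ihom_lp_ext => s u y.
by rewrite !ihom_lp_mapE ch_dd !linear0.
Qed.

Program Definition ihom_lp_complex_map (K L : chain_complex k Rp) (N N' : pm)
    (F : chain_map K L) (a : pmor N N') :
    cochain_map (ihom_lp_complex L N) (ihom_lp_complex K N') :=
  @CochainMap _ _ _ (ihom_lp_complex L N) (ihom_lp_complex K N')
    (fun n => ihom_lp_map (F n) a) _.
Next Obligation.
move=> K L N N' F a n t x; apply: ihom_lp_ext => s u y.
by rewrite !ihom_lp_mapE chm_comm.
Qed.

Definition Ext_lp (i : nat) (M : pm) (Q : projective_resolution M) (N : pm) :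
    pm :=
  cohomology (ihom_lp_complex Q N) i.

End InternalHomLp.

Section SimplicialChains.
Variables (d : Order.disp_t) (V : orderType d).

Record simplicial_complex := SimplicialComplex {
  is_simplex :> pred {fset V};
  simplex_neq0 : forall s, is_simplex s -> s != fset0;
  simplex_face : forall s t,
    is_simplex s -> t `<=` s -> t != fset0 -> is_simplex t }.

Variable X : simplicial_complex.

Definition simplex := {s : {fset V} | X s}.

Definition nsimplex n := {s : simplex | #|` sval s| == n.+1}.

Definition vertices n (s : nsimplex n) : {fset V} := sval (sval s).

Section Face.
Variables (n : nat) (s : nsimplex n.+1) (v : vertices s).

Lemma card_face : #|` vertices s `\ val v| == n.+1.
Proof.
by have := svalP s; rewrite -/(vertices s) (cardfsD1 (val v)) fsvalP.
Qed.

Lemma face_subproof : X (vertices s `\ val v).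
Proof.
apply: (simplex_face (svalP (sval s))); first exact: fsubD1set.
by rewrite -cardfs_gt0 (eqP card_face).
Qed.

Definition face : nsimplex n :=
  exist _ (exist _ (vertices s `\ val v) face_subproof) card_face.

End Face.

Variable k : fieldType.

Definition chains n : lmodType k := {malg k[nsimplex n]}.

(* Simplices are oriented by the order on V: the face opposite to the i-th
   vertex has coefficient (-1)^i. *)
Definition vertex_index n (s : nsimplex n) (v : V) : nat :=
  #|` [fset w in vertices s | (w < v)%O]|.

Definition simplex_boundary n (s : nsimplex n.+1) : chains n :=
  \sum_(v : vertices s) (-1) ^+ vertex_index s (val v) *: << face v >>.

Definition boundary_fun n (c : chains n.+1) : chains n :=
  \sum_(s <- msupp c) c@_s *: simplex_boundary s.

Lemma boundary_funEw n (c : chains n.+1) (D : {fset nsimplex n.+1}) :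
  msupp c `<=` D -> boundary_fun c = \sum_(s <- D) c@_s *: simplex_boundary s.
Proof.
move=> cD; rewrite /boundary_fun; apply: big_fset_incl => // s sD.
by rewrite -mcoeff_eq0 => /eqP ->; rewrite scale0r.
Qed.

Lemma boundary_linear n : linear (@boundary_fun n).
Proof.
move=> a x y; pose D := msupp (a *: x + y) `|` (msupp x `|` msupp y).
have xD : msupp x `<=` D by rewrite /D fsubsetU // fsubsetUl orbT.
have yD : msupp y `<=` D by rewrite /D fsubsetU // fsubsetUr orbT.
have xyD : msupp (a *: x + y) `<=` D by exact: fsubsetUl.
rewrite (boundary_funEw xD) (boundary_funEw yD) (boundary_funEw xyD).
rewrite scaler_sumr -big_split /=; apply: eq_bigr => s _.
by rewrite mcoeffD mcoeffZ scalerDl scalerA.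
Qed.

Definition boundary n : {linear chains n.+1 -> chains n} :=
  mk_linear (@boundary_linear n).

Lemma boundary_simplex n (s : nsimplex n.+1) :
  boundary n << s >> = simplex_boundary s.
Proof.
rewrite -[LHS]/(boundary_fun << s >>).
rewrite (@boundary_funEw _ _ [fset s]) ?msuppU_le //.
by rewrite big_seq_fset1 mcoeffUU scale1r.
Qed.

(* << s >> if s is an n-simplex of X, and 0 otherwise *)
Definition set_chain n (s : {fset V}) : chains n :=
  if insub s is Some s1 then
    if (insub (s1 : simplex) : option (nsimplex n)) is Some s2 then << s2 >>
    else 0
  else 0.

Lemma set_chainE n (s : nsimplex n) : set_chain n (vertices s) = << s >>.
Proof.
rewrite /set_chain.
case: insubP => [s1 _ s1E|/negP[]]; last exact: svalP (sval s).
have {s1E} -> : s1 = sval s by exact: val_inj.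
case: insubP => [s2 _ s2E|/negP[]]; last exact: svalP s.
by congr << _ >>; exact: val_inj.
Qed.

Lemma simplex_boundaryE n (s : nsimplex n.+1) :
  simplex_boundary s = \sum_(v <- vertices s)
    (-1) ^+ #|` [fset w in vertices s | (w < v)%O]| *:
      set_chain n (vertices s `\ v).
Proof.
rewrite big_seq_fsetE; apply: eq_bigr => v _.
by rewrite -[_ `\ _]/(vertices (face v)) set_chainE.
Qed.

Lemma simplex_boundary_boundary n (s : nsimplex n.+2) :
  boundary n (simplex_boundary s) = 0.
Proof.
pose S := vertices s.
pose idx (A : {fset V}) v := #|` [fset w in A | (w < v)%O]|.
pose G v w : chains n :=
  (-1) ^+ (idx S v + idx (S `\ v) w) *: set_chain n (S `\ v `\ w).
have -> : boundary n (simplex_boundary s) =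
    \sum_(v <- S) \sum_(w <- S | w != v) G v w.
  transitivity (\sum_(v : S) \sum_(w <- S | w != val v) G (val v) w);
    last first.
    by rewrite [RHS]big_seq_fsetE.
  rewrite /simplex_boundary linear_sum /=; apply: eq_bigr => v _.
  rewrite linearZ /= /linear_fun.
  rewrite -[boundary_fun _]/(boundary n << face v >>) boundary_simplex.
  rewrite simplex_boundaryE -[vertices (face v)]/(S `\ val v) scaler_sumr.
  have SvE : [fset w in S | w != val v] = S `\ val v.
    by apply/fsetP => w; rewrite !inE andbC.
  rewrite [RHS]big_fset_condE SvE; apply: eq_bigr => w _.
  by rewrite /G scalerA -exprD.
have idxlt v w : v \in S -> (v < w)%O -> idx S w = (idx (S `\ v) w).+1.
  move=> vS vw; rewrite /idx (cardfsD1 v) !inE vS vw /= add1n.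
  congr (#|` _|.+1).
  by apply/fsetP => u; rewrite !inE; case: (u == v).
have idxge v w : (w < v)%O -> idx (S `\ v) w = idx S w.
  move=> wv; rewrite /idx; congr #|` _|; apply/fsetP => u; rewrite !inE.
  by case: eqP => //= ->; rewrite lt_gtF // andbF.
have Ganti v w : v \in S -> (v < w)%O -> G v w = - G w v.
  move=> vS vw; rewrite /G (idxge w v vw) (idxlt v w vS vw).
  rewrite addSn exprS mulN1r scaleNr opprK addnC; congr (_ *: set_chain n _).
  by apply/fsetP => u; rewrite !inE andbCA.
have split_neq v : \sum_(w <- S | w != v) G v w =
    \sum_(w <- S | (v < w)%O) G v w + \sum_(w <- S | (w < v)%O) G v w.
  rewrite (bigID (fun w => (v < w)%O)) /=; congr (_ + _).
    by apply: eq_bigl => w; case: ltgtP.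
  by apply: eq_bigl => w; case: ltgtP.
under eq_bigr do rewrite split_neq.
rewrite big_split /= [X in _ + X](exchange_big_dep xpredT) //=.
rewrite -big_split big_seq big1 //= => v vS.
rewrite -big_split big1 //= => w vw.
by rewrite Ganti // addNr.
Qed.

Lemma boundary_boundary n (c : chains n.+2) : boundary n (boundary n.+1 c) = 0.
Proof.
rewrite [boundary n.+1 c]/(boundary_fun c) linear_sum big1 // => s _.
rewrite linearZ /= /linear_fun.
rewrite -[boundary_fun _]/(boundary n (simplex_boundary s)).
by rewrite simplex_boundary_boundary scaler0.
Qed.

End SimplicialChains.

Section Subcomplexes.
Variables (d : Order.disp_t) (V : orderType d) (X : simplicial_complex V).

Record subcomplex := Subcomplex {
  in_subcomplex :> pred (simplex X);
  subcomplex_face : forall s t,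
    sval s `<=` sval t -> in_subcomplex t -> in_subcomplex s }.

Variable k : fieldType.

(* the chains of the subcomplex T, as a subspace of the chains of X *)
Program Definition subcomplex_chains (T : subcomplex) n :
    submod (chains X k n) :=
  @Submod _ _ (fun c => forall s, ~~ T (sval s) -> c@_s = 0) _ _ _.
Next Obligation. by move=> T n s _; rewrite mcoeff0. Qed.
Next Obligation.
by move=> T n x y xT yT s sT; rewrite mcoeffD xT // yT // addr0.
Qed.
Next Obligation. by move=> T n a x xT s sT; rewrite mcoeffZ xT // mulr0. Qed.

Lemma subcomplex_boundary (T : subcomplex) n c :
  subcomplex_chains T n.+1 c -> subcomplex_chains T n (boundary X k n c).
Proof.
move=> cT t tT; rewrite -[boundary X k n c]/(boundary_fun c).
rewrite raddf_sum big1 // => s _.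
rewrite [LHS]mcoeffZ.
have [sT|/cT ->] := boolP (T (sval s)); last by rewrite mul0r.
rewrite /simplex_boundary raddf_sum big1 ?mulr0 // => v _.
rewrite [LHS]mcoeffZ mcoeffU; case: eqP => [vt|]; last by rewrite mulr0.
case/negP: tT; rewrite -vt; apply: subcomplex_face sT; exact: fsubD1set.
Qed.

(* C_n(X,T) = C_n(X) / C_n(T) *)
Definition rel_chains (T : subcomplex) n : lmodType k :=
  quot_mod (subcomplex_chains T n).

Definition rel_boundary (T : subcomplex) n :
    {linear rel_chains T n.+1 -> rel_chains T n} :=
  quot_map (@subcomplex_boundary T n).

End Subcomplexes.

Section Filtrations.
Variables (R : realType) (d : Order.disp_t) (V : orderType d).
Variable X : simplicial_complex V.

Local Notation Rp := {nonneg R}.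

Record filtration := Filtration {
  filt_val :> simplex X -> Rp;
  filt_mono : forall s t,
    sval s `<=` sval t -> (filt_val s <= filt_val t)%O }.

(* order-reversing functions on the face poset, such as f_{alpha^p} *)
Record cofiltration := Cofiltration {
  cofilt_val :> simplex X -> Rp;
  cofilt_anti : forall s t,
    sval s `<=` sval t -> (cofilt_val t <= cofilt_val s)%O }.

Program Definition sublevel (f : filtration) (a : Rp) : subcomplex X :=
  @Subcomplex _ _ X (fun s => (f s <= a)%O) _.
Next Obligation. by move=> f a s t st; apply: le_trans; exact: filt_mono. Qed.

(* T_t = X \ g^-1[0,t] *)
Program Definition cosublevel (g : cofiltration) (t : Rp) : subcomplex X :=
  @Subcomplex _ _ X (fun s => ~~ (g s <= t)%O) _.
Next Obligation.
by move=> g t s s' ss'; apply: contra => /(le_trans (cofilt_anti g ss')).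
Qed.

Variable k : fieldType.

(* The direct sum of the modules k[f(s),oo) over the n-simplices s: at a, it
   consists of the finitely supported families c with c_s in k[f(s),oo)_a. *)
Program Definition filt_submod (f : filtration) n (a : Rp) :
    submod (chains X k n) :=
  @Submod _ _ (fun c => forall s : nsimplex X n,
    interval_submod k (f (sval s)) a c@_s) _ _ _.
Next Obligation.
move=> f n a; exact: (submod0 (subcomplex_chains k (sublevel f a) n)).
Qed.
Next Obligation.
move=> f n a; exact: (@submodD _ _ (subcomplex_chains k (sublevel f a) n)).
Qed.
Next Obligation.
move=> f n a; exact: (@submodZ _ _ (subcomplex_chains k (sublevel f a) n)).
Qed.

Lemma filt_submod_sub (f : filtration) n (a b : Rp) (le_ab : (a <= b)%O) c :
  filt_submod f n a c -> filt_submod f n b (idfun c).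
Proof. by move=> cf s; exact: (interval_sub le_ab (cf s)). Qed.

Program Definition filt_module (f : filtration) n : pmod k Rp :=
  @PMod _ _ Rp (fun a => submod_type (filt_submod f n a))
    (fun a b le_ab => submod_map (@filt_submod_sub f n a b le_ab)) _ _.
Next Obligation. by move=> f n a le_aa x; apply: val_inj. Qed.
Next Obligation. by move=> *; apply: val_inj. Qed.

Lemma filt_boundary (f : filtration) n (a : Rp) c :
  filt_submod f n.+1 a c -> filt_submod f n a (boundary X k n c).
Proof. exact: (@subcomplex_boundary _ _ _ k (sublevel f a)). Qed.

Program Definition filt_d (f : filtration) n :
    pmor (filt_module f n.+1) (filt_module f n) :=
  @PMor _ _ _ (filt_module f n.+1) (filt_module f n)
    (fun a => submod_map (@filt_boundary f n a)) _.
Next Obligation. by move=> f n s t le_st x; apply: val_inj. Qed.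

Program Definition filt_complex (f : filtration) : chain_complex k Rp :=
  @ChainComplex _ _ _ (filt_module f) (filt_d f) _.
Next Obligation.
by move=> f n t x; apply: val_inj; exact: boundary_boundary.
Qed.

Section BorelMoore.
Variable g : cofiltration.

Lemma cosublevel_chains n (s t : Rp^d) (le_st : (s <= t)%O) c :
  subcomplex_chains k (cosublevel g s) n c ->
  subcomplex_chains k (cosublevel g t) n (idfun c).
Proof.
move=> cT u uT; apply: cT; apply: contra uT => /= us.
by apply: contra us => /le_trans; apply.
Qed.

(* t |-> C_n(X,T_t), contravariant in t *)
Program Definition rel_module n : pmod k (Rp^d)%type :=
  @PMod _ _ (Rp^d)%type (fun t : Rp^d => rel_chains k (cosublevel g t) n)
    (fun s t le_st => quot_map (@cosublevel_chains n s t le_st)) _ _.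
Next Obligation. by move=> n s le_ss; elim/quot_ind => x; rewrite quot_mapE. Qed.
Next Obligation.
move=> n r s t le_rs le_st le_rt; elim/quot_ind => x.
by rewrite (quot_mapE _ x) !quot_mapE.
Qed.

Program Definition rel_d n : pmor (rel_module n.+1) (rel_module n) :=
  @PMor _ _ _ (rel_module n.+1) (rel_module n)
    (fun t => rel_boundary k (cosublevel g t) n) _.
Next Obligation.
move=> n s t le_st; elim/quot_ind => x.
by rewrite /= /rel_boundary !(quot_mapE _ x) !quot_mapE.
Qed.

Program Definition rel_complex : chain_complex k (Rp^d)%type :=
  @ChainComplex _ _ _ rel_module rel_d _.
Next Obligation.
move=> n t; elim/quot_ind => x.
rewrite /= /rel_boundary (quot_mapE _ x) quot_mapE.
by rewrite boundary_boundary linear0.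
Qed.

Definition BM_homology n : pmod k (Rp^d)%type := homology rel_complex n.

End BorelMoore.

End Filtrations.

Section AlphaFiltration.
Variables (R : realType) (p : {posnum R}).

Record bounded_filtration := BoundedFiltration {
  bf_disp : Order.disp_t;
  bf_vertex : orderType bf_disp;
  bf_complex : simplicial_complex bf_vertex;
  bf_filt : filtration R bf_complex;
  bf_alpha : {nonneg R};
  bf_lt : forall s, (bf_filt s < bf_alpha)%O }.

Definition bf_chains (k : fieldType) (D : bounded_filtration) :
    chain_complex k {nonneg R} :=
  filt_complex k (bf_filt D).

(* k[alpha,oo) *)
Definition bf_module (k : fieldType) (D : bounded_filtration) :
    pmod k {nonneg R} :=
  interval k (bf_alpha D).

Variable D : bounded_filtration.
Local Notation f := (bf_filt D).
Local Notation alpha := (bf_alpha D).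

Definition alpha_val (s : simplex (bf_complex D)) : {nonneg R} :=
  NngNum (powR_ge0 (alpha%:num `^ p%:num - (f s)%:num `^ p%:num) (p%:num)^-1).

Lemma alpha_val_anti s t :
  sval s `<=` sval t -> (alpha_val t <= alpha_val s)%O.
Proof.
move=> st; rewrite -[(_ <= _)%O]/(_ `^ _ <= _ `^ _).
have mono (a b : {nonneg R}) : (a <= b)%O ->
    a%:num `^ p%:num <= b%:num `^ p%:num.
  by move=> ab; apply: ge0_ler_powR; rewrite ?nnegrE.
have ge0 u : 0 <= alpha%:num `^ p%:num - (f u)%:num `^ p%:num.
  by rewrite subr_ge0; exact/mono/ltW/bf_lt.
apply: ge0_ler_powR; rewrite ?nnegrE ?invr_ge0 //.
by rewrite lerD2l lerN2; exact/mono/filt_mono.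
Qed.

(* f_{alpha^p} *)
Definition alpha_filtration : cofiltration R (bf_complex D) :=
  Cofiltration alpha_val_anti.

(* T_t = f^-1[0, max(0, alpha^p - t^p)^(1/p)) *)
Lemma cosublevel_alphaE (t : {nonneg R}) s :
  cosublevel alpha_filtration t s =
  ((f s)%:num <
   Num.max 0 (alpha%:num `^ p%:num - t%:num `^ p%:num) `^ (p%:num)^-1).
Proof.
have lt_root (a b : R) : 0 <= a -> 0 <= b ->
    (a < b `^ (p%:num)^-1) = (a `^ p%:num < b).
  move=> a0 b0; apply/idP/idP => [ab|].
    rewrite -[ltRHS]powRr1 // -(mulVf (x := p%:num)) // powRrM.
    by rewrite gt0_ltr_powR ?nnegrE ?powR_ge0.
  apply: contraTT; rewrite -!leNgt => ba.
  rewrite -[leLHS]powRr1 // -(mulVf (x := p%:num)) // powRrM.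
  by rewrite ge0_ler_powR ?nnegrE ?powR_ge0.
have fa : (f s)%:num `^ p%:num <= alpha%:num `^ p%:num.
  by apply: ge0_ler_powR; rewrite ?nnegrE //; exact/ltW/bf_lt.
rewrite -[LHS]/(~~ (_ `^ _ <= t%:num)) -ltNge !lt_root ?subr_ge0 //.
by rewrite lt_max ltNge powR_ge0 /= !ltrBrDr addrC.
Qed.

End AlphaFiltration.

(* Main.v *)
Require Import Defs.
From mathcomp Require Import all_boot all_order all_algebra.
From mathcomp.multinomials Require Import monalg.
From mathcomp Require Import boolp classical_sets functions reals exp.
From mathcomp Require Import interval_inference.
(* Hom and interval below are those of the persistence modules *)
Import Defs.

(** Write A = k[alpha,oo).  The limit that defines [ihom_lp M A] at t runs over
    a poset with least element (0,t), and M is constant in the second variable.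
    Hence an element at t is nothing but a compatible family of functionals
    [M a -> k] that vanish when (a^p + t^p)^(1/p) < alpha, that is, a
    functional on colim M that vanishes on the image of the modules [M a] with
    a [small] for t.  The values [hval] of such a family determine it
    ([hval_inj]), and [hom_extend] builds families by extending functionals
    defined on a part of M.  All exactness below comes from two facts:
    functionals over a field extend, and directed colimits are exact.

    Borel-Moore homology.  For M = C_n the colimit is C_n(X), and a simplex s
    appears at a small parameter exactly when it lies in T_t.  So the cochain
    complex at t is the dual of the relative chains C(X,T_t), and dualizing
    commutes with homology ([cohomology_BM_dual]).

    The exact sequence.  It holds for every chain complex K of persistence
    modules with injective structure maps.  A submodule of a projective module
    over R_+ need not be projective, so the boundaries cannot be split off
    degree by degree; instead, the exactness of M |-> (colim over small a ->
    colim) shows that Ext^1(M,A)_t is the dual of the kernel of this map: a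
    class m of M that is born at a small a and dies at b has a lift q in Q_0
    that becomes a boundary d w at b, and a cocycle x takes the value x(w).  In
    the same way, if m is the homology class of a cycle z of K and z = d c at
    b, a cocycle y on K that vanishes on cycles takes the value y(c).  The
    connecting map matches the cocycles x and y with the same values
    ([connects]); both directions are instances of [hom_transfer], and
    [hom_factor] says that a family of values that vanish comes from a
    coboundary.  The definition involves no choice, so it is natural.

    The splitting must be natural in t.  It suffices to extend functionals
    from the cycles Z of V = colim K_n to V linearly, in such a way that a
    functional that vanishes on Z /\ D_t, where D_t is the image of the small
    parameters, extends to one that vanishes on D_t, for all t at once.  For
    finitely many t, composition with a projection V -> Z that preserves these
    D_t does it ([flag_proj]); the general case follows by passing to the
    limit over the finite sets of parameters, where limit means a linear
    functional that extends the eventual value of eventually constant families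
    ([limit_functional], [evaluation_split]). *)

Set Implicit Arguments.
Unset Strict Implicit.
Unset Printing Implicit Defensive.

Import Order.TTheory GRing.Theory Num.Theory.
Local Open Scope ring_scope.

(** * Extension of linear maps *)

Section LinearRelations.
Variables (k : fieldType).
Implicit Types (U V : lmodType k).

(** Maps out of quotients, colimits and (co)homology are defined below by their
    graphs: a relation lets the representative be chosen freely, and single
    valuedness is the independence of that choice. *)
Definition linear_rel U V (G : U -> V -> Prop) : Prop :=
  G 0 0 /\ forall c x y x' y', G x y -> G x' y' -> G (c *: x + x') (c *: y + y').

Definition single_valued U V (G : U -> V -> Prop) : Prop :=
  forall y, G 0 y -> y = 0.

Lemma single_valuedP U V (G : U -> V -> Prop) x y y' :
  linear_rel G -> single_valued G -> G x y -> G x y' -> y = y'.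
Proof.
move=> [_ Glin] G0 Gy Gy'; apply/esym/eqP; rewrite -subr_eq0; apply/eqP/G0.
by have := Glin (-1) _ _ _ _ Gy Gy'; rewrite !scaleN1r addNr addrC.
Qed.

(** A maximal single-valued linear extension of the graph is total: at a vector
    outside its domain, the value 0 would extend it further. *)
Lemma extend_linear_rel U V (G : U -> V -> Prop) :
  linear_rel G -> single_valued G ->
  exists f : {linear U -> V}, forall x y, G x y -> f x = y.
Proof.
move=> Glin Gsv.
pose H (A : set (U * V)) x y := G x y \/ A (x, y).
have [|A [[Alin Asv] Amax]] :=
  @Zorn_bigcup _ (fun A => linear_rel (H A) /\ single_valued (H A)).
  move=> F FP Ftot; split; last first.
    move=> y [/Gsv//|[A FA Ay]]; have [_ Asv] := FP _ FA.
    by apply: Asv; right.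
  split=> [|c x y x' y'] /=; first by left; exact: Glin.1.
  have join A : F A -> forall x y, H A x y -> H (\bigcup_(X in F) X)%classic x y.
    by move=> FA u v [?|?]; [left|right; exists A].
  move=> [Gy|[A FA Ay]] [Gy'|[A' FA' Ay']]; first by left; exact: Glin.2.
  - by apply: (join A') => //; apply: (FP _ FA').1.2; [left|right].
  - by apply: (join A) => //; apply: (FP _ FA).1.2; [right|left].
  have [AA'|A'A] := Ftot _ _ FA FA'.
    by apply: (join A') => //; apply: (FP _ FA').1.2; right => //; exact: AA'.
  by apply: (join A) => //; apply: (FP _ FA).1.2; right => //; exact: A'A.
have Atot x0 : exists y, H A x0 y.
  apply: contrapT => nx0.
  pose B : set (U * V) := fun z => exists c x, z.1 = c *: x0 + x /\ H A x z.2.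
  have HB x y : H B x y <-> B (x, y).
    split=> [[Gxy|//]|]; last by right.
    by exists 0, x; rewrite scale0r add0r; split=> //; left.
  apply: (Amax B).
    split=> [[x y] Axy|].
      by exists 0, x; split; [rewrite scale0r add0r|right].
    have Bx0 : B (x0, 0).
      by exists 1, 0; split; [rewrite scale1r addr0|left; exact: Glin.1].
    by move=> /(_ _ Bx0) Ax0; apply: nx0; exists 0; right.
  split.
    split=> [|c x y x' y']; first by left; exact: Glin.1.
    rewrite !HB => -[a [u [/= -> Hu]]] [a' [u' [/= -> Hu']]].
    exists (c * a + a'), (c *: u + u'); split=> /=; last exact: Alin.2.
    by rewrite scalerDr scalerDl scalerA addrACA.
  move=> y /HB[c [u [/= /esym u0 Hu]]].
  have [c0|c0] := eqVneq c 0.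
    by apply: Asv; move: u0; rewrite c0 scale0r add0r => <-.
  case: nx0; exists (- c^-1 *: y + 0).
  have -> : x0 = - c^-1 *: u + 0.
    move/eqP: u0; rewrite addrC addr_eq0 => /eqP ->.
    by rewrite scalerN scaleNr opprK scalerA mulVf // scale1r addr0.
  by apply: Alin.2 => //; exact: Alin.1.
have [f fH] := choice Atot.
have sv := single_valuedP Alin Asv.
have flin : linear f.
  by move=> c x y; apply: sv (fH _) _; exact: Alin.2.
exists (mk_linear flin) => x y Gxy; apply: sv (fH _) _.
by left.
Qed.

Lemma linear_of_rel U V (G : U -> V -> Prop) :
  linear_rel G -> single_valued G -> (forall x, exists y, G x y) ->
  exists f : {linear U -> V}, forall x, G x (f x).
Proof.
move=> Glin Gsv Gtot; have [f fE] := extend_linear_rel Glin Gsv.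
by exists f => x; have [y Gxy] := Gtot x; rewrite (fE _ _ Gxy).
Qed.

(** The finite subsets of T are directed by inclusion, so the eventual value is
    well defined and linear on the eventually constant families.  Extended to
    all families, it is a limit that always exists and is still linear. *)
Lemma limit_functional (T : eqType) : exists L : (seq T -> k^o) -> k^o,
  linear L /\ forall f v (J0 : seq T),
    (forall J : seq T, {subset J0 <= J} -> f J = v) -> L f = v.
Proof.
pose G (f : seq T -> k^o) (v : k^o) :=
  exists J0 : seq T, forall J : seq T, {subset J0 <= J} -> f J = v.
have Glin : linear_rel G.
  split=> [|c f v f' v' [J fJ] [J' fJ']]; first by exists [::].
  exists (J ++ J') => K sK; rewrite -[LHS]/(c *: f K + f' K).
  by rewrite fJ ?fJ' // => x xJ; apply: sK; rewrite mem_cat xJ ?orbT.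
have Gsv : single_valued G.
  by move=> v [J /(_ J (fun=> id))] <-.
have [L LG] := extend_linear_rel Glin Gsv.
exists L; split=> [|f v J0 fv]; first exact: linearP.
by apply: LG; exists J0.
Qed.

(* projection onto S *)
Lemma submod_proj V (S : submod V) :
  exists r : {linear V -> V}, (forall v, S (r v)) /\ (forall v, S v -> r v = v).
Proof.
pose G (v : V) (w : submod_type S) := \val w = v.
have Glin : linear_rel G.
  by split=> [|c x y x' y' <- <-]; rewrite /G ?raddf0 // linearP.
have Gsv : single_valued G by move=> y y0; exact: val_inj.
have [f fG] := extend_linear_rel Glin Gsv.
exists (\val \o f); split=> v /=; first exact/submod_predP/valP.
move=> /submod_predP Sv; by rewrite (fG v (SubmodType Sv)).
Qed.

Definition cap_submod V (S T : submod V) : submod V.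
Proof.
exists (fun v => S v /\ T v).
- by split; exact: submod0.
- by move=> x y [Sx Tx] [Sy Ty]; split; exact: submodD.
- by move=> c x [Sx Tx]; split; exact: submodZ.
Defined.

Lemma submodN V (S : submod V) v : S v -> S (- v).
Proof. by rewrite -scaleN1r; exact: submodZ. Qed.

Lemma submodB V (S : submod V) v w : S v -> S w -> S (v - w).
Proof. by move=> Sv Sw; apply: submodD => //; exact: submodN. Qed.

(** Two compatible projections: p onto D, and q onto Z /\ D, such that p maps Z
    into Z /\ D.  On D + Z, p sends x + z to x + q z, which is well defined
    because q is the identity where x and z overlap. *)
Lemma proj_pair V (Z D : submod V) : exists p q : {linear V -> V},
  [/\ forall v, D (p v), forall v, D v -> p v = v,
      forall v, Z v -> p v = q v,
      forall v, Z (q v) /\ D (q v)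
    & forall v, Z v -> D v -> q v = v].
Proof.
have [q [qE q_id]] := submod_proj (cap_submod Z D).
have [d [dD d_id]] := submod_proj D.
pose G v w := exists x z, [/\ D x, Z z, v = x + z & w = x + q z].
have Glin : linear_rel G.
  split=> [|c _ _ _ _ [x [z [Dx Zz -> ->]]] [x' [z' [Dx' Zz' -> ->]]]].
    by exists 0, 0; rewrite linear0 addr0; split=> //; exact: submod0.
  exists (c *: x + x'), (c *: z + z'); split.
  - by apply: submodD => //; exact: submodZ.
  - by apply: submodD => //; exact: submodZ.
  - by rewrite scalerDr addrACA.
  - by rewrite linearP scalerDr addrACA.
have Gsv : single_valued G.
  move=> w [x [z [Dx Zz /esym/eqP]]]; rewrite addr_eq0 => /eqP xE ->.
  rewrite q_id ?xE ?addNr //; split=> //.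
  by rewrite -[z]opprK -xE; exact: submodN.
have [g gE] := extend_linear_rel Glin Gsv.
exists (d \o g), q; split=> [v|v Dv|v Zv|v|v Zv Dv] /=.
- exact: dD.
- rewrite (gE v v) ?d_id //; exists v, 0; rewrite linear0 !addr0; split=> //.
  exact: submod0.
- rewrite (gE v (q v)) ?d_id //; first exact: (qE v).2.
  by exists 0, v; rewrite !add0r; split=> //; exact: submod0.
- exact: qE.
- exact: q_id.
Qed.

(** Induction on a flag that starts with its smallest member D: with p and q as
    in [proj_pair], correct the projection r of the rest to q p + r (1 - p).
    The larger members contain the image of p, so they are still preserved. *)
Lemma flag_proj (T : eqType) V (Z : submod V) (D : T -> submod V) :
  (forall i j, (forall v, D i v -> D j v) \/ (forall v, D j v -> D i v)) ->
  forall J : seq T,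
  exists r : {linear V -> V}, [/\ forall v, Z (r v), forall v, Z v -> r v = v
    & forall i v, i \in J -> D i v -> D i (r v)].
Proof.
move=> Dchain J; pose le i j := `[< forall v, D i v -> D j v >].
have le_total : total le.
  by move=> i j; apply/orP; have [?|?] := Dchain i j; [left|right]; exact/asboolP.
have le_trans : transitive le.
  move=> j i l /asboolP ij /asboolP jl; apply/asboolP => v /ij; exact: jl.
suff : forall s, sorted le s -> exists r : {linear V -> V},
    [/\ forall v, Z (r v), forall v, Z v -> r v = v
      & forall i v, i \in s -> D i v -> D i (r v)].
  move=> /(_ (sort le J) (sort_sorted le_total J)) [r [rZ r_id rD]].
  by exists r; split=> // i v iJ; apply: rD; rewrite mem_sort.
elim=> [_|i s IHs]; first by have [r [? ?]] := submod_proj Z; exists r.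
rewrite /= path_sortedE // => /andP[/allP i_min /IHs[r [rZ r_id rD]]].
have [p' [q [pD p_id pZ qZD q_id]]] := proj_pair Z (D i).
pose r' v := q (p' v) + r (v - p' v).
have r'lin : linear r'.
  move=> c x y; rewrite /r' scalerDr addrACA -!linearP; congr (_ + r _).
  by rewrite linearP opprD addrACA -scalerN -scalerDr.
exists (mk_linear r'lin); split=> [v|v Zv|j v]; rewrite /= /linear_fun.
- by apply: submodD => //; exact: (qZD _).1.
- rewrite /r' (pZ _ Zv) (q_id _ (qZD v).1 (qZD v).2) r_id; first by rewrite addrC subrK.
  by apply: submodB => //; exact: (qZD v).1.
- rewrite inE => /predU1P[->|js] Dv.
    by rewrite /r' p_id // subrr linear0 addr0; exact: (qZD v).2.
  have /asboolP ij := i_min _ js.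
  apply: submodD; first by apply: ij; exact: (qZD _).2.
  by apply: rD => //; apply: submodB => //; apply: ij; exact: pD.
Qed.

End LinearRelations.

(** * Persistence modules, their morphisms and their colimits *)

Section Relations.
Variables (k : fieldType) (d : Order.disp_t) (P : porderType d).
Implicit Types M N : pmod k P.

Definition stable_rel M N (G : forall t, M t -> N t -> Prop) : Prop :=
  forall s t (le_st : (s <= t)%O) x y,
    G s x y -> G t (pm_map M le_st x) (pm_map N le_st y).

(** Stability of the graph under the structure maps is naturality, since the
    values are unique. *)
Lemma pmor_of_rel M N (G : forall t, M t -> N t -> Prop) :
  (forall t, linear_rel (@G t)) -> (forall t, single_valued (@G t)) ->
  (forall t x, exists y, G t x y) -> stable_rel G ->
  {f : pmor M N | forall t x, G t x (f t x)}.
Proof.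
move=> Glin Gsv Gtot Gst.
have f t : {f : {linear M t -> N t} | forall x, G t x (f x)}.
  by apply: cid; exact: linear_of_rel.
have fnat s t (le_st : (s <= t)%O) x :
    sval (f t) (pm_map M le_st x) = pm_map N le_st (sval (f s) x).
  apply: single_valuedP (svalP (f t) _) _ => //.
  by apply: Gst; exact: (svalP (f s)).
by exists (PMor fnat) => t x; exact: (svalP (f t)).
Qed.

Lemma iso_of_rel M N (G : forall t, M t -> N t -> Prop) :
  (forall t, linear_rel (@G t)) -> (forall t, single_valued (@G t)) ->
  (forall t x, G t x 0 -> x = 0) ->
  (forall t x, exists y, G t x y) -> (forall t y, exists x, G t x y) ->
  stable_rel G -> pmod_iso M N.
Proof.
move=> Glin Gsv Ginj Gtot Gsurj Gst.
pose G' t y x := G t x y.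
have G'lin t : linear_rel (@G' t).
  by split=> [|c x y x' y'] //; [exact: (Glin t).1|exact: (Glin t).2].
have G'sv t : single_valued (@G' t) by move=> x; exact: Ginj.
have [f fG] := pmor_of_rel Glin Gsv Gtot Gst.
have [|g gG] := pmor_of_rel G'lin G'sv Gsurj; first by move=> *; exact: Gst.
exists f, g; split=> t x.
  exact: (single_valuedP (G'lin t) (@G'sv t)) (gG t _) (fG t x).
exact: (single_valuedP (Glin t) (@Gsv t)) (fG t _) (gG t x).
Qed.

Lemma pm_map_irr M s t (le1 le2 : (s <= t)%O) : pm_map M le1 = pm_map M le2.
Proof. by rewrite (bool_irrelevance le1 le2). Qed.

Definition pm_inj M : Prop :=
  forall s t (le_st : (s <= t)%O) x, pm_map M le_st x = 0 -> x = 0.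

End Relations.

Section Colimits.
Variables (k : fieldType) (d : Order.disp_t) (P : orderType d).
Variable (M : pmod k P).

Definition compatible_from (t : P) (x : dprod M) : Prop :=
  forall s u (le_su : (s <= u)%O), (t <= s)%O -> pm_map M le_su (x s) = x u.

Lemma dprodDE (x y : dprod M) s : (x + y) s = x s + y s. Proof. by []. Qed.
Lemma dprodBE (x y : dprod M) s : (x - y) s = x s - y s. Proof. by []. Qed.
Lemma dprodZE c (x : dprod M) s : (c *: x) s = c *: x s. Proof. by []. Qed.

Program Definition compatible_submod t : submod (dprod M) :=
  @Submod k (dprod M) (compatible_from t) _ _ _.
Next Obligation. by move=> t s u le_su ts; rewrite linear0. Qed.
Next Obligation.
by move=> t x y xC yC s u le_su ts; rewrite !dprodDE linearD xC // yC.
Qed.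
Next Obligation.
by move=> t c x xC s u le_su ts; rewrite !dprodZE linearZ /= xC.
Qed.

Definition extend_from (t : P) (m : M t) : dprod M := fun s =>
  if pselect (t <= s)%O is left le_ts then pm_map M le_ts m else 0.

Lemma extend_fromE t m s (le_ts : (t <= s)%O) :
  extend_from m s = pm_map M le_ts m.
Proof.
rewrite /extend_from; case: pselect => // le_ts'.
by rewrite (pm_map_irr _ le_ts').
Qed.

Lemma extend_from_linear t : linear (@extend_from t).
Proof.
move=> c x y; apply: functional_extensionality_dep => s.
rewrite dprodDE dprodZE /extend_from; case: pselect => [le_ts|_].
  by rewrite linearP.
by rewrite scaler0 addr0.
Qed.

Lemma extend_from_compatible t (m : M t) : compatible_from t (extend_from m).
Proof.
move=> s u le_su ts; rewrite (extend_fromE _ ts).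
by rewrite (extend_fromE _ (le_trans ts le_su)); exact: pm_map_comp.
Qed.

Lemma compatible_le s t (x : dprod M) :
  (s <= t)%O -> compatible_submod s x -> compatible_submod t (idfun x).
Proof.
by move=> le_st xC r u le_ru tr; apply: xC; exact: le_trans tr.
Qed.

(** The module of families that are compatible from t on.  Its structure maps
    are inclusions, and evaluation at t maps it onto M. *)
Program Definition cover : pmod k P :=
  @PMod _ _ P (fun t => submod_type (compatible_submod t))
    (fun s t le_st => submod_map (fun x => @compatible_le s t x le_st)) _ _.
Next Obligation. by move=> s le_ss x; exact: val_inj. Qed.
Next Obligation. by move=> *; exact: val_inj. Qed.

Definition eval_at t (x : cover t) : M t := (\val x : dprod M) t.

Lemma eval_at_linear t : linear (@eval_at t).
Proof. by []. Qed.

Program Definition cover_map : pmor cover M :=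
  @PMor _ _ P cover M (fun t => mk_linear (@eval_at_linear t)) _.
Next Obligation.
move=> s t le_st x; rewrite /= /linear_fun /eval_at /=.
by have /submod_predP xC := valP x; rewrite xC.
Qed.

(** A projective module embeds into its [cover], where the structure maps are
    injective. *)
Lemma projective_inj : projective M -> pm_inj M.
Proof.
move=> Mproj.
have [t y|h hE] := Mproj cover M cover_map (pmor_id M).
  have yC : extend_from y \in submod_pred (compatible_submod t).
    by apply/submod_predP; exact: extend_from_compatible.
  exists (SubmodType yC); rewrite /= /linear_fun /eval_at /=.
  by rewrite (extend_fromE _ (lexx t)) pm_map_id.
move=> s t le_st x Mx0; rewrite -[x](hE s x).
have -> : h s x = 0; last exact: linear0.
apply: val_inj; have := pmor_natural h le_st x.
by rewrite Mx0 linear0 => /(congr1 val) /= <-.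
Qed.

Section Directed.
Variable t0 : P.

(** The colimit of M is realized by the germs at infinity of families that are
    eventually compatible. *)
Program Definition germ_submod : submod (dprod M) :=
  @Submod k (dprod M) (fun x => exists t, compatible_from t x) _ _ _.
Next Obligation. by exists t0; exact: (submod0 (compatible_submod t0)). Qed.
Next Obligation.
move=> x y [s xC] [t yC]; exists (Order.max s t).
apply: (submodD (s := compatible_submod _)).
  by apply: compatible_le xC; rewrite le_max lexx.
by apply: compatible_le yC; rewrite le_max lexx orbT.
Qed.
Next Obligation.
move=> c x [s xC]; exists s.
exact: (submodZ (s := compatible_submod s)).
Qed.

Program Definition null_submod : submod (dprod M) :=
  @Submod k (dprod M) (fun x => exists t, forall s, (t <= s)%O -> x s = 0)
    _ _ _.
Next Obligation. by exists t0. Qed.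
Next Obligation.
move=> x y [s x0] [t y0]; exists (Order.max s t) => u.
by rewrite ge_max => /andP[su tu]; rewrite dprodDE x0 // y0 // addr0.
Qed.
Next Obligation.
by move=> c x [s x0]; exists s => u su; rewrite dprodZE x0 // scaler0.
Qed.

Lemma germ_ofP t (m : M t) : extend_from m \in submod_pred germ_submod.
Proof.
by apply/submod_predP; exists t; exact: extend_from_compatible.
Qed.

Definition germ_of t (m : M t) : subquot germ_submod null_submod :=
  quot_proj _ (SubmodType (germ_ofP m)).

Lemma germ_of_linear t : linear (@germ_of t).
Proof.
move=> c x y; rewrite /germ_of -linearP; congr (quot_proj _ _).
by apply: val_inj; exact: extend_from_linear.
Qed.

Lemma colimit_exists : exists (W : lmodType k) (i : forall a, {linear M a -> W}),
  (forall a b (le_ab : (a <= b)%O) m, i b (pm_map M le_ab m) = i a m) /\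
  forall a m, i a m = 0 ->
    exists b (le_ab : (a <= b)%O), pm_map M le_ab m = 0.
Proof.
exists (subquot germ_submod null_submod).
exists (fun a => mk_linear (@germ_of_linear a)).
rewrite /= /linear_fun /germ_of; split=> [a b le_ab m|a m].
- apply/quot_proj_eq; exists b => s bs /=.
  rewrite /linear_fun dprodBE (extend_fromE _ bs).
  rewrite (extend_fromE _ (le_trans le_ab bs)).
  by rewrite (pm_map_comp _ _ (le_trans le_ab bs)) subrr.
- move=> /quot_proj_eq0[t m0]; exists (Order.max a t).
  have le_am : (a <= Order.max a t)%O by rewrite le_max lexx.
  exists le_am; rewrite -extend_fromE; apply: m0.
  by rewrite le_max lexx orbT.
Qed.

End Directed.

(** The graph G induces a single-valued graph on the colimit, because a value at
    an element that dies at b is a value at 0 in [M b]. *)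
Lemma extend_family (t0 : P) (G : forall a, M a -> k^o -> Prop) :
  (forall a, linear_rel (@G a)) -> (forall a, single_valued (@G a)) ->
  (forall a b (le_ab : (a <= b)%O) m v, G a m v -> G b (pm_map M le_ab m) v) ->
  exists phi : forall a, {linear M a -> k^o},
    (forall a b (le_ab : (a <= b)%O) m, phi b (pm_map M le_ab m) = phi a m) /\
    forall a m v, G a m v -> phi a m = v.
Proof.
move=> Glin Gsv Gst; have [W [i [iE i0]]] := colimit_exists t0.
pose H (w : W) (v : k^o) := exists a (m : M a), i a m = w /\ G a m v.
have Hlin : linear_rel H.
  split=> [|c _ v _ v' [a [m [<- Gm]]] [b [m' [<- Gm']]]].
    by exists t0, 0; split; [exact: linear0|exact: (Glin t0).1].
  have le_a : (a <= Order.max a b)%O by rewrite le_max lexx.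
  have le_b : (b <= Order.max a b)%O by rewrite le_max lexx orbT.
  exists (Order.max a b), (c *: pm_map M le_a m + pm_map M le_b m').
  by rewrite linearP !iE; split=> //; apply: (Glin _).2; exact: Gst.
have Hsv : single_valued H.
  move=> v [a [m [/i0[b [le_ab m0]] Gm]]]; apply: (Gsv b).
  by rewrite -m0; exact: Gst.
have [f fE] := extend_linear_rel Hlin Hsv.
exists (fun a => f \o i a); split=> [a b le_ab m|a m v Gm] /=.
  by rewrite iE.
by apply: fE; exists a, m.
Qed.

End Colimits.

(** * Internal hom into an interval module *)

Lemma submod_val_lin (k : fieldType) (V : lmodType k) (S : submod V) c
    (x y : submod_type S) : \val (c *: x + y) = c *: \val x + \val y.
Proof. by []. Qed.

Lemma Hom_app_lin (k : fieldType) (U V : lmodType k) c (f g : Hom U V) u :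
  Hom_app (c *: f + g) u = c *: Hom_app f u + Hom_app g u.
Proof. by []. Qed.

Section Values.
Variables (R : realType) (k : fieldType) (p : {posnum R}) (alpha : {nonneg R}).

Local Notation Rp := {nonneg R}.
Local Notation A := (interval k alpha : pmod k Rp).

(** The least element (0,t) of the index poset of the limit at t: by
    compatibility, an element of the limit is determined by its component there.
    In that component only the maps at the points (a,t) matter, since the first
    argument of the internal hom is constant along the second coordinate. *)
Definition base (t : Rp) : above (@proj2_lp R) t :=
  exist _ ((0%:nng, t) : (Rp *p Rp)%type) (lexx t).

Lemma base_le (t a : Rp) : (sval (base t) <= ((a, t) : (Rp *p Rp)%type))%O.
Proof. by apply/andP; split; [exact: (ge0 a)|exact: lexx]. Qed.

Definition at_height (t a : Rp) : upset (sval (base t)) :=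
  exist _ ((a, t) : (Rp *p Rp)%type) (base_le t a).

Section HomAt.
Variables (M N : pmod k (Rp *p Rp)%type) (q : (Rp *p Rp)%type).

Definition hom_at (eta : submod_type (nat_submod M N q)) u :
    Hom (M (sval u)) (N (sval u)) :=
  \val eta u.

Lemma hom_at_lin c eta eta' u :
  hom_at (c *: eta + eta') u = c *: hom_at eta u + hom_at eta' u.
Proof. by []. Qed.

End HomAt.

Definition slice (M : pmod k Rp) t (x : ihom_lp p M A t) :
    submod_type (nat_submod (pullback (@proj1_lp_homo R) M)
      (pullback (@lp_norm_homo R p) A) (sval (base t))) :=
  \val x (base t).

Lemma slice_lin (M : pmod k Rp) t c (x y : ihom_lp p M A t) :
  slice (c *: x + y) = c *: slice x + slice y.
Proof. by []. Qed.

Definition hval (M : pmod k Rp) t (x : ihom_lp p M A t) a (m : M a) : k^o :=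
  \val (Hom_app (hom_at (slice x) (at_height t a)) m).

(** The parameters a where the module k[alpha,oo) vanishes at (a,t): they form an
    initial segment, which shrinks as t grows. *)
Definition small (t a : Rp) : bool := ~~ (alpha <= lp_norm p (a, t))%O.

Lemma smallE t a : small t a = ~~ (alpha <= lp_norm p (a, t))%O.
Proof. by []. Qed.

Section Fixed.
Variables (M : pmod k Rp) (t : Rp).
Implicit Types (x y : ihom_lp p M A t).

Lemma hval_linearr x a : linear (@hval M t x a).
Proof. by move=> c m m'; rewrite /hval linearP. Qed.

Lemma hval_linearl c x y a (m : M a) :
  hval (c *: x + y) m = c *: hval x m + hval y m.
Proof.
by rewrite /hval slice_lin hom_at_lin Hom_app_lin submod_val_lin.
Qed.

Lemma hval_map x a b (le_ab : (a <= b)%O) m :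
  hval x (pm_map M le_ab m) = hval x m.
Proof.
have /submod_predP xN := valP (\val x (base t)).
have le : (sval (at_height t a) <= sval (at_height t b))%O.
  by apply/andP; split=> //; exact: lexx.
have := xN _ _ le m.
rewrite /hval.
rewrite (_ : pm_map (pullback (@proj1_lp_homo R) M) le m = pm_map M le_ab m).
  by move=> ->.
by rewrite (pm_map_irr M le_ab (proj1_lp_homo le)).
Qed.

Lemma hval_small x a (m : M a) : small t a -> hval x m = 0.
Proof.
rewrite /hval => ta; set v := Hom_app _ _.
by have /submod_predP := valP v; apply.
Qed.

(** All components are transported from (0,t), and all points over a given a from
    (a,t). *)
Lemma hvalE x s u m :
  \val (Hom_app (\val (\val x s) u) m) = hval x (m : M (sval u).1).
Proof.
have /submod_predP xC := valP x.
have le_s : (sval (base t) <= sval s)%O.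
  by apply/andP; split; [exact: (ge0 (sval s).1)|exact: (svalP s)].
have xs : \val x s = ihom_res _ _ le_s (slice x) := esym (xC (base t) s le_s).
rewrite -[LHS]/(\val (Hom_app (hom_at (\val x s) u) m)) xs.
have /submod_predP xN := valP (slice x).
have le_u : (sval (at_height t (sval u).1) <= sval (upset_incl le_s u))%O.
  apply/andP; split=> /=; first exact: lexx.
  by have /andP[_] := svalP u; apply: le_trans; exact: (svalP s).
have := xN _ _ le_u m.
rewrite (_ : pm_map (pullback (@proj1_lp_homo R) M) le_u m = m).
  by move=> /(congr1 val).
exact: (pm_map_id (p := M)).
Qed.

Lemma hval0r x a : hval x (0 : M a) = 0.
Proof. exact: (linear0 (mk_linear (@hval_linearr x a))). Qed.

Lemma hvalBr x a (m m' : M a) : hval x (m - m') = hval x m - hval x m'.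
Proof. exact: (linearB (mk_linear (@hval_linearr x a))). Qed.

Lemma hval0l a (m : M a) : hval (0 : ihom_lp p M A t) m = 0.
Proof.
have := hval_linearl (-1) 0 0 m.
by rewrite scaler0 addr0 scaleN1r addNr.
Qed.

Lemma hval_inj x y : (forall a (m : M a), hval x m = hval y m) -> x = y.
Proof.
by move=> xy; apply: ihom_lp_ext => s u m; apply: val_inj; rewrite !hvalE.
Qed.

Lemma hval_exists (phi : forall a, {linear M a -> k^o}) :
  (forall a b (le_ab : (a <= b)%O) m, phi b (pm_map M le_ab m) = phi a m) ->
  (forall a m, small t a -> phi a m = 0) ->
  exists x, forall a m, hval x m = phi a m.
Proof.
move=> phiE phi0.
pose F := ihom (pullback (@proj1_lp_homo R) M) (pullback (@lp_norm_homo R p) A).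
have valP_ (s : above (@proj2_lp R) t) (u : upset (sval s)) m :
    (phi (sval u).1 m : k^o) \in
      submod_pred (interval_submod k alpha (lp_norm p (sval u))).
  apply/submod_predP => /= nle; apply: phi0; apply: contra nle => /le_trans; apply.
  apply: lp_norm_homo; apply/andP; split; first exact: lexx.
  by apply: le_trans (svalP s) _; have /andP[] := svalP u.
pose h0 s u (m : M (sval u).1) : A (lp_norm p (sval u)) :=
  SubmodType (valP_ s u m).
have h0lin s u : linear (h0 s u).
  by move=> c m m'; apply: val_inj; rewrite /= linearP.
have h1P s u : (h0 s u : _ -> _) \in
    submod_pred (linear_submod (M (sval u).1) (A (lp_norm p (sval u)))).
  by apply/submod_predP; exact: h0lin.
pose h2 s : hom_family (pullback (@proj1_lp_homo R) M)
    (pullback (@lp_norm_homo R p) A) (sval s) := fun u => SubmodType (h1P s u).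
have h2P s : h2 s \in submod_pred (nat_submod _ _ _).
  apply/submod_predP => u u' le_u m; apply: val_inj => /=.
  exact: phiE.
pose h3 : lim_family (@proj2_lp R) F t := fun s => SubmodType (h2P s).
have h3P : h3 \in submod_pred (lim_submod _ _ _).
  apply/submod_predP => s s' le_s; apply: val_inj.
  apply: functional_extensionality_dep => u; apply: val_inj; apply: funext => m.
  exact: val_inj.
by exists (SubmodType h3P).
Qed.

(** The extension principle behind all the constructions of homomorphisms below.
    The last hypothesis puts the value 0 at the small parameters into G, which
    is what makes the extended functional take values in k[alpha,oo). *)
Lemma hom_extend (G : forall a, M a -> k^o -> Prop) :
  (forall a, linear_rel (@G a)) -> (forall a, single_valued (@G a)) ->
  (forall a b (le_ab : (a <= b)%O) m v, G a m v -> G b (pm_map M le_ab m) v) ->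
  (forall a m, small t a -> G a m 0) ->
  exists x : ihom_lp p M A t, forall a m v, G a m v -> hval x m = v.
Proof.
move=> Glin Gsv Gst G0.
have [phi [phiE phiG]] := extend_family 0%:nng Glin Gsv Gst.
have [|x xE] := hval_exists phiE; first by move=> a m /(G0 a m); exact: phiG.
by exists x => a m v /phiG; rewrite xE.
Qed.

End Fixed.

Lemma hval_restrict (M : pmod k Rp) t t' (le_t : (t <= t')%O)
    (x : ihom_lp p M A t) a (m : M a) :
  hval (pm_map (ihom_lp p M A) le_t x) m = hval x m.
Proof.
exact: (hvalE (s := above_incl le_t (base t')) x
  (u := (at_height t' a : upset (sval (above_incl le_t (base t'))))) m).
Qed.

Lemma small_le t t' a b : (t <= t')%O -> (a <= b)%O -> small t' b -> small t a.
Proof.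
move=> tt' ab; apply: contra => /le_trans; apply.
by apply: lp_norm_homo; apply/andP.
Qed.

End Values.

(** The image of the generator at alpha' determines the morphism; it is 0 unless
    the target is already alive there. *)
Lemma interval_map_scalar (R : realType) (k : fieldType)
    (alpha alpha' : {nonneg R})
    (f : pmor (interval k alpha' : pmod k {nonneg R}) (interval k alpha)) :
  exists c : k, (c != 0 -> (alpha <= alpha')%O) /\
    forall s y, \val (f s y) = c *: (\val y : k^o).
Proof.
have oneP : (1 : k^o) \in submod_pred (interval_submod k alpha' alpha').
  by apply/submod_predP; rewrite /= lexx.
pose one : interval k alpha' alpha' := SubmodType oneP.
exists (\val (f _ one)); split=> [|s y].
  apply: contra_neqT => nle.
  by have /submod_predP := valP (f _ one); apply.
have [le_s|nle_s] := boolP (alpha' <= s)%O.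
  have {1}-> : y = (\val y : k) *: pm_map (interval k alpha') le_s one.
    by apply: val_inj; rewrite /= /linear_fun /= [RHS]mulr1.
  rewrite linearZ pmor_natural /=; exact: mulrC.
have -> : y = 0 by apply: val_inj; have /submod_predP := valP y; apply.
by rewrite linear0 /= scaler0.
Qed.

Section ValueMaps.
Variables (R : realType) (k : fieldType) (p : {posnum R}) (alpha alpha' : {nonneg R}).
Local Notation Rp := {nonneg R}.

Lemma hval_precomp (M M' : pmod k Rp) (g : pmor M' M) t
    (x : ihom_lp p M (interval k alpha) t) a (m : M' a) :
  hval (ihom_lp_map p g (pmor_id (interval k alpha)) t x) m = hval x (g a m).
Proof. by []. Qed.

Lemma hval_ihom_map (f : pmor (interval k alpha' : pmod k Rp) (interval k alpha)) :
  exists c : k, (c != 0 -> (alpha <= alpha')%O) /\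
    forall (M M' : pmod k Rp) (g : pmor M' M) t
    (x : ihom_lp p M (interval k alpha') t) a (m : M' a),
  hval (ihom_lp_map p g f t x) m = c *: hval x (g a m).
Proof.
have [c [c0 cE]] := interval_map_scalar f.
exists c; split=> // M M' g t x a m.
exact: cE.
Qed.

Lemma small_alpha t a : (alpha <= alpha')%O -> small p alpha t a -> small p alpha' t a.
Proof. by move=> le_alpha; apply: contra; exact: le_trans. Qed.

End ValueMaps.

(* Unification must not unfold the values into the nested limits. *)
Global Opaque hval small.

(** * Representatives of homology classes *)

Section SubquotientClasses.
Variables (k : fieldType) (d : Order.disp_t) (P : porderType d).
Implicit Types M N : pmod k P.

Definition represents M (Z B : subpmod M) t (x : M t) (X : subquot_pmod Z B t) :
  Prop :=
  exists z : submod_type (Z t), \val z = x /\ quot_proj (submod_in (Z t) (B t)) z = X.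

Section Fixed.
Variables (M : pmod k P) (Z B : subpmod M).
Implicit Types (t : P).

Lemma represents_lin t : linear_rel (@represents M Z B t).
Proof.
split=> [|c x X y Y [z [<- <-]] [w [<- <-]]].
  by exists 0; split; last exact: linear0.
by exists (c *: z + w); split; last exact: linearP.
Qed.

Lemma represents_ex t (X : subquot_pmod Z B t) : exists x, represents x X.
Proof. by elim/quot_ind: X => z; exists (\val z), z. Qed.

Lemma represents_in t x (X : subquot_pmod Z B t) : represents x X -> Z t x.
Proof. by case=> z [<- _]; apply/submod_predP/valP. Qed.

Lemma represents_of t x : Z t x -> exists X : subquot_pmod Z B t, represents x X.
Proof.
move=> /submod_predP Zx; exists (quot_proj (submod_in (Z t) (B t)) (SubmodType Zx)).
by exists (SubmodType Zx).
Qed.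

Lemma represents0 t x (X : subquot_pmod Z B t) : represents x X -> (X = 0 <-> B t x).
Proof. by case=> z [<- <-]; exact: quot_proj_eq0. Qed.

Lemma represents_sv t : single_valued (@represents M Z B t).
Proof. by move=> X /represents0 ->; exact: submod0. Qed.

Lemma represents_stable s t (le_st : (s <= t)%O) x (X : subquot_pmod Z B s) :
  represents x X -> represents (pm_map M le_st x) (pm_map (subquot_pmod Z B) le_st X).
Proof.
move=> [z [<- <-]].
exists (submod_map (@subpm_stable _ _ _ _ Z s t le_st) z); split=> //.
by rewrite /= /subquot_pmod_map (subquot_mapE _ _ z).
Qed.

End Fixed.

Lemma represents_map M N (Z B : subpmod M) (Z' B' : subpmod N) (g : pmor M N)
    (gZ : forall t x, Z t x -> Z' t (g t x)) (gB : forall t x, B t x -> B' t (g t x))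
    t x (X : subquot_pmod Z B t) :
  represents x X -> represents (g t x) (subquot_pmor gZ gB t X).
Proof.
move=> [z [<- <-]]; exists (submod_map (@gZ t) z); split=> //.
by rewrite /= (subquot_mapE _ _ z).
Qed.

End SubquotientClasses.

Section Preceding.
Variables (k : fieldType) (d : Order.disp_t) (P : porderType d).
Implicit Types K L : chain_complex k P.

Lemma zero_pmod_eq0 t (x : zero_pmod k P t) : x = 0.
Proof. by apply/rowP => -[]. Qed.

Lemma to_zero_linear (M : pmod k P) t :
  linear (fun _ : M t => 0 : zero_pmod k P t).
Proof. by move=> c x y; rewrite scaler0 addr0. Qed.

Program Definition to_zero (M : pmod k P) : pmor M (zero_pmod k P) :=
  @PMor _ _ _ M (zero_pmod k P) (fun t => mk_linear (@to_zero_linear M t)) _.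
Next Obligation. by []. Qed.

(** The complex is continued by 0 below degree 0, so that degree 0 needs no
    separate treatment: there the cycles are the whole module and
    [homology_pred] is 0. *)
Definition prev K n : pmod k P := if n is m.+1 then K m else zero_pmod k P.

Definition prev_d K n : pmor (K n) (prev K n) :=
  match n return pmor (K n) (prev K n) with
  | 0%N => to_zero (K 0%N)
  | m.+1 => ch_d K m
  end.

Lemma cyclesE K n t x : cycles K n t x <-> prev_d K n t x = 0.
Proof. by case: n x. Qed.

Lemma prev_dd K n t x : prev_d K n t (ch_d K n t x) = 0.
Proof. by case: n x => //= n x; exact: ch_dd. Qed.

Definition prev_represents K n t : prev K n t -> homology_pred K n t -> Prop :=
  match n return prev K n t -> homology_pred K n t -> Prop with
  | 0%N => fun _ _ => True
  | m.+1 => @represents _ _ _ _ (cycles K m) (im_subpmod (ch_d K m)) t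
  end.

Section Fixed.
Variables (K : chain_complex k P) (n : nat).

Lemma prev_represents_lin t : linear_rel (@prev_represents K n t).
Proof. by case: n => [//|m]; exact: represents_lin. Qed.

Lemma prev_represents_ex t h : exists z, @prev_represents K n t z h.
Proof. by case: n h => [|m] h; [exists 0|exact: represents_ex]. Qed.

Lemma prev_represents_sv t : single_valued (@prev_represents K n t).
Proof.
by case: n => [h _|m]; [exact: zero_pmod_eq0|exact: represents_sv].
Qed.

Lemma prev_represents_stable s t (le_st : (s <= t)%O) z h :
  @prev_represents K n s z h ->
  prev_represents (pm_map (prev K n) le_st z) (pm_map (homology_pred K n) le_st h).
Proof. by case: n z h => [//|m] z h; exact: represents_stable. Qed.

Lemma prev_represents0 t z :
  @prev_represents K n t z 0 <-> exists c, prev_d K n t c = z.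
Proof.
case: n z => [|m] z /=; first by split=> // _; exists 0; rewrite (zero_pmod_eq0 z).
split=> [/represents0[/(_ erefl)]//|[c cz]].
have [|X zX] := @represents_of _ _ _ _ (cycles K m) (im_subpmod (ch_d K m)) t z.
  by apply/cyclesE; rewrite -cz prev_dd.
by have <- : X = 0; [apply/(represents0 zX); exists c|].
Qed.

(** If the chain z becomes a boundary later, it is a cycle later, and hence
    already now because the structure maps are injective. *)
Lemma prev_represents_cycle s t (le_st : (s <= t)%O) z c :
  (forall m, pm_inj (K m)) -> prev_d K n t c = pm_map (prev K n) le_st z ->
  exists h, @prev_represents K n s z h.
Proof.
move=> Kinj; case: n z c => [|m] z c /=; first by exists 0.
move=> dc.
have [|X zX] := @represents_of _ _ _ _ (cycles K m) (im_subpmod (ch_d K m)) s z.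
  case: m z c dc => [//|m] z c dc /=.
  by apply: (Kinj _ _ _ le_st); rewrite -pmor_natural -dc ch_dd.
by exists X.
Qed.

End Fixed.

Lemma prev_inj K n : (forall m, pm_inj (K m)) -> pm_inj (prev K n).
Proof. by move=> Kinj; case: n => // s t le_st x; rewrite (zero_pmod_eq0 x). Qed.

Section Maps.
Variables (K L : chain_complex k P) (F : chain_map K L) (n : nat).

Definition prev_map : pmor (prev K n) (prev L n) :=
  match n return pmor (prev K n) (prev L n) with
  | 0%N => zero_pmor k P
  | m.+1 => F m
  end.

Lemma prev_map_d t c : prev_map t (prev_d K n t c) = prev_d L n t (F n t c).
Proof.
rewrite /prev_map; case: n c => [|m] c /=; last exact: chm_comm.
exact: zero_pmod_eq0.
Qed.

Lemma prev_represents_map t z h : @prev_represents K n t z h ->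
  prev_represents (prev_map t z) (homology_pred_map F n t h).
Proof.
by rewrite /prev_map; case: n z h => [//|m] z h; exact: represents_map.
Qed.

End Maps.
End Preceding.

(** * Small parameters, transfer and factorization of functionals *)

Section Pushed.
Variables (R : realType) (k : fieldType) (p : {posnum R}) (alpha : {nonneg R}).
Local Notation Rp := {nonneg R}.
Local Notation A := (interval k alpha : pmod k Rp).
Local Notation small := (small p alpha).

Definition stable_linear_rel (N Q : pmod k Rp) (rho : forall a, N a -> Q a -> Prop) :=
  (forall a, linear_rel (@rho a)) /\ stable_rel rho.

(** The pairs at b that come from rho-related pairs at a small parameter.
    The pair (0,0) is included even if no parameter is small, which happens for
    t >= alpha; the relation is then still linear. *)
Definition pushed (N Q : pmod k Rp) (rho : forall a, N a -> Q a -> Prop) t b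
    (z : N b) (q : Q b) : Prop :=
  (z = 0 /\ q = 0) \/ exists a (le_ab : (a <= b)%O) z' q',
    [/\ small t a, rho a z' q', z = pm_map N le_ab z' & q = pm_map Q le_ab q'].

Section Fixed.
Variables (N Q : pmod k Rp) (rho : forall a, N a -> Q a -> Prop).
Hypothesis rhoSL : stable_linear_rel rho.
Variable t : Rp.

Lemma pushed_lin b : linear_rel (@pushed N Q rho t b).
Proof.
have [rho_lin rho_st] := rhoSL.
have up c z q z' q' : @pushed N Q rho t b z q -> @pushed N Q rho t b z' q' ->
    z = 0 /\ q = 0 \/ z' = 0 /\ q' = 0 ->
    @pushed N Q rho t b (c *: z + z') (c *: q + q').
  move=> H H' [[z0 q0]|[z0 q0]]; first by rewrite z0 q0 !scaler0 !add0r.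
  rewrite z0 q0 !addr0; case: H => [[-> ->]|[a [le_ab [w [r [ta Hw -> ->]]]]]].
    by left; rewrite !scaler0.
  right; exists a, le_ab, (c *: w), (c *: r); split=> //; try by rewrite linearZ.
  by have := (rho_lin a).2 c _ _ _ _ Hw (rho_lin a).1; rewrite !addr0.
split=> [|c z q z' q' H H']; first by left.
case: (H) (H') => [[? ?]|[a [le_ab [w [r [ta Hw zE qE]]]]]].
  by move=> _; apply: up => //; left.
case=> [[? ?]|[a' [le_ab' [w' [r' [ta' Hw' zE' qE']]]]]].
  by apply: up => //; right.
have le_a : (a <= Order.max a a')%O by rewrite le_max lexx.
have le_a' : (a' <= Order.max a a')%O by rewrite le_max lexx orbT.
have le_m : (Order.max a a' <= b)%O by rewrite ge_max le_ab.
right; exists (Order.max a a'), le_m.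
exists (c *: pm_map N le_a w + pm_map N le_a' w').
exists (c *: pm_map Q le_a r + pm_map Q le_a' r'); split.
- by case: leP.
- by apply: (rho_lin _).2; exact: rho_st.
- by rewrite zE zE' linearP !(pm_map_comp _ _ le_ab) !(pm_map_comp _ _ le_ab').
- by rewrite qE qE' linearP !(pm_map_comp _ _ le_ab) !(pm_map_comp _ _ le_ab').
Qed.

Lemma pushed_stable b c (le_bc : (b <= c)%O) z q :
  @pushed N Q rho t b z q ->
  @pushed N Q rho t c (pm_map N le_bc z) (pm_map Q le_bc q).
Proof.
move=> [[-> ->]|[a [le_ab [w [r [ta Hw -> ->]]]]]]; first by left; rewrite !linear0.
right; exists a, (le_trans le_ab le_bc), w, r; split=> //; exact: pm_map_comp.
Qed.

Lemma pushed_small b z q : small t b -> rho z q -> @pushed N Q rho t b z q.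
Proof.
move=> tb zq; right; exists b, (lexx b), z, q.
by split=> //; rewrite pm_map_id.
Qed.

End Fixed.

Definition flip (N Q : pmod k Rp) (rho : forall a, N a -> Q a -> Prop) a q z :=
  rho a z q.

Lemma pushed_flip (N Q : pmod k Rp) (rho : forall a, N a -> Q a -> Prop) t b z q :
  @pushed N Q rho t b z q -> @pushed Q N (flip rho) t b q z.
Proof.
case=> [[-> ->]|[a [le_ab [w [r [ta Hw -> ->]]]]]]; first by left.
by right; exists a, le_ab, r, w.
Qed.

Lemma flipSL (N Q : pmod k Rp) (rho : forall a, N a -> Q a -> Prop) :
  stable_linear_rel rho -> stable_linear_rel (flip rho).
Proof.
move=> [rho_lin rho_st]; split=> [a|a b le_ab q z]; last exact: rho_st.
by split=> [|c x y x' y']; [exact: (rho_lin a).1|exact: (rho_lin a).2].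
Qed.

Definition below (N : pmod k Rp) t b (z : N b) : Prop :=
  @pushed N N (fun a z' q' => z' = q') t b z z.

Lemma belowP (N : pmod k Rp) t b (z : N b) : below t z <-> z = 0 \/
  exists a (le_ab : (a <= b)%O) z', small t a /\ z = pm_map N le_ab z'.
Proof.
split=> [[[-> _]|[a [le_ab [z' [_ [ta _ -> _]]]]]]|[->|[a [le_ab [z' [ta ->]]]]]].
- by left.
- by right; exists a, le_ab, z'.
- by left.
- by right; exists a, le_ab, z', z'.
Qed.

Lemma below_lin (N : pmod k Rp) t b c (z z' : N b) :
  below t z -> below t z' -> below t (c *: z + z').
Proof.
apply: (pushed_lin _ _ _).2; split=> [a|a a' le_a z1 z2 -> //].
by split=> // e x y x' y' -> ->.
Qed.

Lemma pushed_belowl (N Q : pmod k Rp) (rho : forall a, N a -> Q a -> Prop) t b z q :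
  @pushed N Q rho t b z q -> below t z.
Proof.
case=> [[-> _]|[a [le_ab [w [r [ta Hw -> _]]]]]]; first by left.
by right; exists a, le_ab, w, w.
Qed.

Lemma hval_below (N : pmod k Rp) t (x : ihom_lp p N A t) b (z : N b) :
  below t z -> hval x z = 0.
Proof.
case/belowP => [->|[a [le_ab [z' [ta ->]]]]]; first exact: hval0r.
by rewrite hval_map hval_small.
Qed.

(** To have y = e f, the values of e are forced on the image of f, and must be 0
    on what comes from small parameters.  The hypothesis says that these two
    prescriptions agree. *)
Lemma hom_factor (L N : pmod k Rp) (f : pmor L N) t (y : ihom_lp p L A t) :
  (forall b c, below t (f b c) -> hval y c = 0) ->
  exists e : ihom_lp p N A t, forall b c, hval y c = hval e (f b c).
Proof.
move=> y0.
pose G b (z : N b) (v : k^o) := exists c, below t (z - f b c) /\ v = hval y c.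
have [b|b v|a b le_ab z v|b z tb|e eE] := @hom_extend _ _ p alpha N t G.
- split=> [|c z _ z' _ [m [zm ->]] [m' [zm' ->]]].
    by exists 0; rewrite linear0 subr0 hval0r; split=> //; left.
  exists (c *: m + m'); rewrite hval_linearr; split=> //.
  by rewrite linearP opprD addrACA -scalerBr; exact: below_lin.
- move=> [c [bc ->]]; apply: y0.
  have := below_lin (-1) bc (or_introl (conj erefl erefl)).
  by rewrite sub0r scaleN1r opprK addr0.
- move=> [c [bc ->]]; exists (pm_map L le_ab c); rewrite hval_map; split=> //.
  by rewrite pmor_natural -linearB; exact: pushed_stable.
- by exists 0; rewrite hval0r linear0 subr0; split=> //; exact: pushed_small.
- exists e => b c; apply/esym/eE; exists c; rewrite subrr; split=> //; by left.
Qed.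

(** Given a relation rho between the targets of f and g, the value of x at w is
    assigned to each c with f c and g w related by [pushed].  The situation is
    symmetric in f and g; both instances are used to compare cocycles on a
    complex with cocycles on a resolution. *)
Lemma hom_transfer (N L Q0 Q1 : pmod k Rp) (rho : forall a, N a -> Q0 a -> Prop)
    (f : pmor L N) (g : pmor Q1 Q0) t (x : ihom_lp p Q1 A t) :
  stable_linear_rel rho ->
  (forall b w, pushed rho t 0 (g b w) -> hval x w = 0) ->
  (forall b c, small t b -> rho b (f b c) 0) ->
  exists y : ihom_lp p L A t,
    forall b c w, pushed rho t (f b c) (g b w) -> hval y c = hval x w.
Proof.
move=> rhoSL x0 rho0.
pose G b (c : L b) (v : k^o) :=
  exists w, pushed rho t (f b c) (g b w) /\ v = hval x w.
have [b|b v|a b le_ab z v|b z tb|y yE] := @hom_extend _ _ p alpha L t G.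
- split=> [|c z _ z' _ [w [zw ->]] [w' [zw' ->]]].
    by exists 0; rewrite !linear0 hval0r; split=> //; left.
  exists (c *: w + w'); rewrite hval_linearr; split=> //.
  by rewrite !linearP; exact: (pushed_lin rhoSL t b).2.
- by move=> [w [zw ->]]; apply: x0; rewrite linear0 in zw.
- move=> [w [zw ->]]; exists (pm_map Q1 le_ab w); rewrite hval_map; split=> //.
  by rewrite !pmor_natural; exact: pushed_stable.
- exists 0; rewrite hval0r linear0; split=> //; apply: pushed_small => //.
  exact: rho0.
- by exists y => b c w cw; apply: yE; exists w.
Qed.

End Pushed.

(** * Cohomology classes and their evaluation on homology *)

Section Classes.
Variables (R : realType) (k : fieldType) (p : {posnum R}) (alpha : {nonneg R}).
Local Notation Rp := {nonneg R}.
Local Notation A := (interval k alpha : pmod k Rp).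
Variables (K : chain_complex k Rp) (n : nat).
Local Notation HomK := (ihom_lp_complex p K A).

Definition class_of t (x : ihom_lp p (K n) A t) (X : cohomology HomK n t) : Prop :=
  @represents _ _ _ (HomK n) (ker_subpmod (coch_d HomK n)) (coboundaries HomK n) t x X.

Lemma class_of_lin t : linear_rel (@class_of t).
Proof. exact: represents_lin. Qed.

Lemma class_of_sv t : single_valued (@class_of t).
Proof. exact: represents_sv. Qed.

Lemma class_of_ex t (X : cohomology HomK n t) : exists x, class_of x X.
Proof. exact: represents_ex. Qed.

Lemma class_of_stable s t (le_st : (s <= t)%O) x X : @class_of s x X ->
  class_of (pm_map (ihom_lp p (K n) A) le_st x) (pm_map (cohomology HomK n) le_st X).
Proof. exact: represents_stable. Qed.

Lemma class_of_cocycle t x X b c : @class_of t x X -> hval x (ch_d K n b c) = 0.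
Proof.
move=> /represents_in dx.
have {}dx : ihom_lp_map p (ch_d K n) (pmor_id A) t x = 0 := dx.
by rewrite -hval_precomp dx hval0l.
Qed.

Lemma class_of_cocycle_ex t (x : ihom_lp p (K n) A t) :
  (forall b c, hval x (ch_d K n b c) = 0) -> exists X, class_of x X.
Proof.
move=> dx; apply: represents_of.
apply: (@hval_inj _ _ p alpha (K n.+1) t) => b c.
by rewrite hval_precomp dx hval0l.
Qed.

Lemma class_of0 t x X : @class_of t x X -> X = 0 <->
  exists e : ihom_lp p (prev K n) A t, forall b c, hval x c = hval e (prev_d K n b c).
Proof.
move=> /represents0 ->; case: n x => [|m] x.
  split=> [->|[e xE]]; first by exists 0 => b c; rewrite !hval0l.
  apply: hval_inj => b c.
  by rewrite xE hval0l [prev_d _ _ _ _]zero_pmod_eq0 hval0r.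
split=> [[e <-]|[e xE]]; first by exists e => b c; exact: hval_precomp.
by exists e; apply: hval_inj => b c; rewrite xE; exact: hval_precomp.
Qed.

End Classes.

Lemma class_of_map (R : realType) (k : fieldType) (p : {posnum R})
    (alpha alpha' : {nonneg R})
    (K L : chain_complex k {nonneg R}) (F : chain_map K L) n
    (a : pmor (interval k alpha' : pmod k {nonneg R}) (interval k alpha)) t x
    (X : cohomology (ihom_lp_complex p L (interval k alpha')) n t) :
  class_of x X ->
  class_of (ihom_lp_map p (F n) a t x)
    (cohomology_map (ihom_lp_complex_map p F a) n t X).
Proof. exact: represents_map. Qed.

Section Evaluation.
Variables (R : realType) (k : fieldType) (p : {posnum R}) (alpha : {nonneg R}).
Local Notation Rp := {nonneg R}.
Local Notation A := (interval k alpha : pmod k Rp).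
Variables (K : chain_complex k Rp) (n : nat).
Local Notation HomK := (ihom_lp_complex p K A).

Local Notation hclass := (@represents _ _ _ _ (cycles K n) (im_subpmod (ch_d K n)) _).

(** The graph of the map from the cohomology of the hom complex to the dual of
    homology: restrict a cocycle to the cycles. *)
Definition evaluates t (X : cohomology HomK n t)
    (h : ihom_lp p (homology K n) A t) :=
  exists2 x, class_of x X &
    forall b z eta, hclass z eta -> hval h eta = hval x (z : K n b).

Lemma evaluates_lin t : linear_rel (@evaluates t).
Proof.
split=> [|c X h X' h' [x xX hx] [x' xX' hx']].
  exists 0; first exact: (class_of_lin p alpha K n t).1.
  by move=> b z eta _; rewrite !hval0l.
exists (c *: x + x'); first exact: (class_of_lin p alpha K n t).2.
by move=> b z eta zeta; rewrite !hval_linearl (hx _ _ _ zeta) (hx' _ _ _ zeta).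
Qed.

Lemma evaluates_sv t : single_valued (@evaluates t).
Proof.
move=> h [x /class_of0[/(_ erefl)[e xE] _] hx]; apply: hval_inj => b eta.
have [z zeta] := represents_ex eta.
rewrite (hx _ _ _ zeta) xE hval0l.
by have /cyclesE -> := represents_in zeta; rewrite hval0r.
Qed.

Lemma evaluates_ex t X : exists h, @evaluates t X h.
Proof.
have [x xX] := class_of_ex X.
pose G b (eta : homology K n b) (v : k^o) := exists z, hclass z eta /\ v = hval x z.
have [b|b v|a b le_ab eta v|b eta tb|h hE] :=
  @hom_extend _ _ p alpha (homology K n) t G.
- split=> [|c eta _ eta' _ [z [zc ->]] [z' [zc' ->]]].
    by exists 0; rewrite hval0r; split=> //; exact: (represents_lin _ _ _).1.
  exists (c *: z + z'); rewrite hval_linearr; split=> //.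
  exact: (represents_lin _ _ _).2.
- move=> [z [/represents0[/(_ erefl)[c <-] _] ->]].
  exact: class_of_cocycle xX.
- move=> [z [zc ->]]; exists (pm_map (K n) le_ab z); rewrite hval_map.
  by split=> //; exact: represents_stable.
- by have [z zc] := represents_ex eta; exists z; rewrite hval_small.
- by exists h, x => // b z eta zc; apply: hE; exists z.
Qed.

Lemma evaluates_stable : stable_rel evaluates.
Proof.
move=> s t le_st X h [x xX hx].
exists (pm_map (ihom_lp p (K n) A) le_st x); first exact: class_of_stable.
by move=> b z eta zeta; rewrite !hval_restrict (hx _ _ _ zeta).
Qed.

Definition evaluation : pmor (cohomology HomK n) (ihom_lp p (homology K n) A) :=
  sval (pmor_of_rel evaluates_lin evaluates_sv evaluates_ex evaluates_stable).

Lemma evaluationP t X : evaluates X (evaluation t X).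
Proof. exact: svalP (pmor_of_rel _ _ _ _) t X. Qed.

Lemma evaluationE t x X b z (eta : homology K n b) :
  class_of x X -> hclass z eta -> hval (evaluation t X) eta = hval x z.
Proof.
move=> xX zeta; have [y yX hy] := evaluationP X.
apply: etrans (hy b z eta zeta) _; apply/eqP; rewrite -subr_eq0; apply/eqP.
have := class_of_lin p alpha K n t; move=> /proj2 /(_ (-1) _ _ _ _ xX yX).
rewrite !scaleN1r addNr => /class_of0[/(_ erefl)[e eE] _].
have := eE b z; rewrite -scaleN1r hval_linearl scaleN1r addrC => ->.
by have /cyclesE -> := represents_in zeta; rewrite hval0r.
Qed.

Lemma evaluation_eq0 t x X : @class_of _ _ p alpha K n t x X ->
  evaluation t X = 0 <-> forall b z, prev_d K n b z = 0 -> hval x z = 0.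
Proof.
move=> xX; split=> [X0 b z /cyclesE zc|x0].
  have [eta zeta] := @represents_of _ _ _ _ _ (im_subpmod (ch_d K n)) _ _ zc.
  by rewrite -(evaluationE xX zeta) X0 hval0l.
apply: hval_inj => b eta; have [z zeta] := represents_ex eta.
rewrite (evaluationE xX zeta) hval0l; apply: x0; apply/cyclesE.
exact: represents_in zeta.
Qed.

End Evaluation.

(** * The connecting map from Ext *)

Section Connecting.
Variables (R : realType) (k : fieldType) (p : {posnum R}) (alpha : {nonneg R}).
Local Notation Rp := {nonneg R}.
Local Notation A := (interval k alpha : pmod k Rp).
Variables (K : chain_complex k Rp) (n : nat).
Hypothesis Kinj : forall m, pm_inj (K m).
Variable Q : projective_resolution (homology_pred K n).
Local Notation HomK := (ihom_lp_complex p K A).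
Local Notation HomQ := (ihom_lp_complex p Q A).

(** The pairs (z,q) with the same image in homology: z as a cycle of K, q in the
    first term of the resolution.  If such a pair is born at a small parameter
    and both become boundaries at b, z = d c and q = d w, then c and w detect the
    same element of the kernel of (colimit over small parameters -> colimit) of
    the homology module. *)
Definition lifts_cycle a (z : prev K n a) (q : Q 0%N a) : Prop :=
  prev_represents z (res_aug Q a q).

Local Notation linked t z q := (@pushed _ _ p alpha _ _ lifts_cycle t _ z q).

Lemma lifts_cycleSL : stable_linear_rel lifts_cycle.
Proof.
split=> [a|a b le_ab z q zq]; last first.
  by rewrite /lifts_cycle pmor_natural; exact: prev_represents_stable.
split=> [|c z q z' q' zq zq']; rewrite /lifts_cycle.
  by rewrite linear0; exact: (prev_represents_lin _ _ _).1.
by rewrite linearP; exact: (prev_represents_lin _ _ _).2.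
Qed.

Lemma lifts_cycle0l a q : lifts_cycle (0 : prev K n a) q -> exists w, ch_d Q 0 a w = q.
Proof. by move=> /prev_represents_sv /res_aug_exact. Qed.

Lemma lifts_cycle0r a z : lifts_cycle z (0 : Q 0%N a) <-> exists c, prev_d K n a c = z.
Proof. by rewrite /lifts_cycle linear0; exact: prev_represents0. Qed.

(** This lemma and the next make the transfer well defined: the value of a
    cocycle at w depends only on the homology class that w bounds.  A second
    lift of this class differs by a boundary in Q_0 at the small parameter where
    all values vanish; this uses that the structure maps are injective. *)
Lemma linked_res t x b w : (forall b c, hval x (ch_d Q 1 b c) = 0) ->
  linked t (0 : prev K n b) (ch_d Q 0 b w) -> @hval R k p alpha (Q 1%N) t x b w = 0.
Proof.
move=> dx; have res0 c u : ch_d Q 0 c u = 0 -> hval x u = 0.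
  by move=> /res_exact[v <-]; exact: dx.
case=> [[_]|[a [le_ab [z [q [ta zq /esym z0 qE]]]]]]; first exact: res0.
move: zq; rewrite (prev_inj Kinj z0) => /lifts_cycle0l[v vq].
have := res0 b (w - pm_map (Q 1%N) le_ab v).
rewrite linearB pmor_natural vq qE subrr => /(_ erefl).
by rewrite hvalBr hval_map (hval_small _ _ ta) subr0.
Qed.

Lemma linked_cycle t y b c : (forall b c, prev_d K n b c = 0 -> hval y c = 0) ->
  linked t (prev_d K n b c) (0 : Q 0%N b) -> @hval R k p alpha (K n) t y b c = 0.
Proof.
move=> y0; case=> [[dc _]|[a [le_ab [z [q [ta zq dc /esym q0]]]]]]; first exact: y0.
move: zq; rewrite (projective_inj (@res_projective _ _ _ _ Q 0%N) q0).
move=> /lifts_cycle0r[v vz].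
have := y0 b (c - pm_map (K n) le_ab v).
rewrite linearB pmor_natural vz dc subrr => /(_ erefl).
by rewrite hvalBr hval_map (hval_small _ _ ta) subr0.
Qed.

(** Each boundary that comes from a small parameter on one side is linked to one
    on the other side; this is what makes the comparison injective. *)
Lemma linked_exr t b c : @below _ _ p alpha _ t b (prev_d K n b c) ->
  exists w, linked t (prev_d K n b c) (ch_d Q 0 b w).
Proof.
case/belowP => [dc|[a [le_ab [z [ta dc]]]]].
  by exists 0; rewrite linear0; left.
have [h zh] := prev_represents_cycle Kinj dc.
have [q qh] := res_aug_surj Q h.
have zq : lifts_cycle z q by rewrite /lifts_cycle qh.
have := (lifts_cycleSL.2 _ _ le_ab _ _ zq); rewrite -dc => dcq.
have /res_aug_exact[w wq] : res_aug Q b (pm_map (Q 0%N) le_ab q) = 0.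
  apply: (single_valuedP (prev_represents_lin K n b)
    (@prev_represents_sv _ _ _ K n b)) dcq _.
  by apply/prev_represents0; exists c.
by exists w; rewrite wq; right; exists a, le_ab, z, q.
Qed.

Lemma linked_exl t b w : @below _ _ p alpha _ t b (ch_d Q 0 b w) ->
  exists c, linked t (prev_d K n b c) (ch_d Q 0 b w).
Proof.
case/belowP => [dw|[a [le_ab [q [ta dw]]]]].
  by exists 0; rewrite linear0; left.
have [z zq] := prev_represents_ex (res_aug Q a q).
have := (lifts_cycleSL.2 _ _ le_ab _ _ zq); rewrite -dw /lifts_cycle.
have -> : res_aug Q b (ch_d Q 0 b w) = 0 by apply/res_aug_exact; exists w.
move=> /prev_represents0[c cz]; exists c; right.
by exists a, le_ab, z, q.
Qed.

Definition linked_values t (x : ihom_lp p (Q 1%N) A t) (y : ihom_lp p (K n) A t) :=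
  forall b c w, linked t (prev_d K n b c) (ch_d Q 0 b w) -> hval y c = hval x w.

Definition connects t (X : Ext_lp p 1 Q A t) (Y : cohomology HomK n t) : Prop :=
  exists x y, [/\ class_of (K := Q) (n := 1%N) x X, class_of y Y & linked_values x y].

Lemma connects_lin t : linear_rel (@connects t).
Proof.
split=> [|c X Y X' Y' [x [y [xX yY xy]]] [x' [y' [xX' yY' xy']]]].
  exists 0, 0; split; [exact: (class_of_lin _ _ _ _ _).1..|].
  by move=> b c w _; rewrite !hval0l.
exists (c *: x + x'), (c *: y + y'); split; [exact: (class_of_lin _ _ _ _ _).2..|].
by move=> b e w ew; rewrite !hval_linearl (xy _ _ _ ew) (xy' _ _ _ ew).
Qed.

(** Cochains linked to a coboundary vanish on the boundaries that come from small
    parameters, so they factor through the differential. *)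
Lemma connects_sv t : single_valued (@connects t).
Proof.
move=> Y [x [y [xX yY xy]]]; apply/(class_of0 yY).
have [e xE] := (class_of0 xX).1 erefl.
apply: hom_factor => b c /linked_exr[w cw]; rewrite (xy _ _ _ cw) xE.
by apply: hval_below; exact: pushed_belowl (pushed_flip cw).
Qed.

Lemma connects_inj t X : @connects t X 0 -> X = 0.
Proof.
move=> [x [y [xX yY xy]]]; apply/(class_of0 xX).
have [e yE] := (class_of0 yY).1 erefl.
apply: hom_factor => b w /linked_exl[c cw]; rewrite -(xy _ _ _ cw) yE.
by apply: hval_below; exact: pushed_belowl cw.
Qed.

Lemma linked_values_cycle t x y : @linked_values t x y ->
  forall b c, prev_d K n b c = 0 -> hval y c = 0.
Proof.
by move=> xy b c dc; rewrite (xy b c 0) ?hval0r // linear0; left.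
Qed.

Lemma connects_ex t X : exists Y, @connects t X Y.
Proof.
have [x xX] := class_of_ex X.
have [||y yx] := @hom_transfer _ _ p alpha _ (K n) _ _ _
  (prev_d K n) (ch_d Q 0) t x lifts_cycleSL.
- by move=> b w; apply: linked_res => b' c; exact: class_of_cocycle xX.
- by move=> b c _; apply/lifts_cycle0r; exists c.
have [|Y yY] := @class_of_cocycle_ex _ _ p alpha K n t y.
  by move=> b c; apply: (linked_values_cycle yx); exact: prev_dd.
exists Y, x, y; split; [exact: xX|exact: yY|exact: yx].
Qed.

(** A cocycle that vanishes on cycles has values that depend only on the homology
    class bounded; transferred to the resolution, it becomes an extension
    class. *)
Lemma connects_exact t Y : (exists X, @connects t X Y) <-> evaluation p alpha K n t Y = 0.
Proof.
split=> [[X [x [y [xX yY /linked_values_cycle xy]]]]|Y0].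
  exact/(evaluation_eq0 yY).
have [y yY] := class_of_ex Y.
have /(evaluation_eq0 yY) y0 := Y0.
have [||x xy] := @hom_transfer _ _ p alpha _ (Q 1%N) _ _ _
  (ch_d Q 0) (prev_d K n) t y (flipSL lifts_cycleSL).
- by move=> b c /pushed_flip; exact: linked_cycle.
- move=> b w _; rewrite /flip /lifts_cycle.
  have -> : res_aug Q b (ch_d Q 0 b w) = 0 by apply/res_aug_exact; exists w.
  exact: (prev_represents_lin _ _ _).1.
have [|X xX] := @class_of_cocycle_ex _ _ p alpha Q 1 t x.
  by move=> b c; rewrite (xy b _ 0) ?hval0r // ch_dd linear0; left.
exists X, x, y; split; [exact: xX|exact: yY|move=> b c w cw].
apply/esym/xy; exact: pushed_flip cw.
Qed.

Lemma connects_stable : stable_rel connects.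
Proof.
move=> s t le_st X Y [x [y [xX yY xy]]].
exists (pm_map (ihom_lp p (Q 1%N) A) le_st x), (pm_map (ihom_lp p (K n) A) le_st y).
split; [exact: class_of_stable..|] => b c w cw; rewrite !hval_restrict; apply: xy.
case: cw => [?|[a [le_ab [z [q [ta zq cz wq]]]]]]; [by left|right].
exists a, le_ab, z, q; split; [|exact: zq|exact: cz|exact: wq].
exact: small_le le_st (lexx a) ta.
Qed.

Definition connecting : pmor (Ext_lp p 1 Q A) (cohomology HomK n) :=
  sval (pmor_of_rel connects_lin connects_sv connects_ex connects_stable).

Lemma connectingP t X : connects X (connecting t X).
Proof. exact: svalP (pmor_of_rel _ _ _ _) t X. Qed.

Lemma connecting_eq t X Y : connects X Y -> connecting t X = Y.
Proof. exact: single_valuedP (connects_lin t) (@connects_sv t) (connectingP X). Qed.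

Lemma connecting_inj t : injective (connecting t).
Proof.
apply: raddf_inj => X X0; apply: connects_inj; rewrite -X0.
exact: connectingP.
Qed.

Lemma connecting_exact t Y :
  evaluation p alpha K n t Y = 0 <-> exists X, connecting t X = Y.
Proof.
split=> [/connects_exact[X XY]|[X <-]]; first by exists X; exact: connecting_eq.
by apply/connects_exact; exists X; exact: connectingP.
Qed.

End Connecting.

Section Naturality.
Variables (R : realType) (k : fieldType) (p : {posnum R}) (alpha alpha' : {nonneg R}).
Local Notation Rp := {nonneg R}.
Local Notation A := (interval k alpha : pmod k Rp).
Local Notation A' := (interval k alpha' : pmod k Rp).
Variables (K K' : chain_complex k Rp) (F : chain_map K K') (n : nat) (a : pmor A' A).

Lemma evaluation_natural t X :
  evaluation p alpha K n t (cohomology_map (ihom_lp_complex_map p F a) n t X) =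
  ihom_lp_map p (homology_map F n) a t (evaluation p alpha' K' n t X).
Proof.
have [x xX] := class_of_ex X; have [c [_ cE]] := hval_ihom_map p a.
apply: hval_inj => b eta; have [z zeta] := represents_ex eta.
apply: etrans (evaluationE (class_of_map F a xX) zeta) _.
rewrite !cE; congr (_ *: _); apply/esym/(evaluationE xX).
exact: represents_map.
Qed.

Hypothesis Kinj : forall m, pm_inj (K m).
Hypothesis K'inj : forall m, pm_inj (K' m).
Variables (Q : projective_resolution (homology_pred K n)).
Variables (Q' : projective_resolution (homology_pred K' n)).
Variables (G : chain_map Q Q').
Hypothesis FG : lifts_to_resolutions (homology_pred_map F n) G.

Lemma connecting_natural t X :
  connecting p alpha Kinj Q t (cohomology_map (ihom_lp_complex_map p G a) 1 t X) =
  cohomology_map (ihom_lp_complex_map p F a) n t (connecting p alpha' K'inj Q' t X).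
Proof.
apply: connecting_eq.
have [x [y [xX yY xy]]] := connectingP K'inj X.
exists (ihom_lp_map p (G 1%N) a t x), (ihom_lp_map p (F n) a t y).
split; [exact: (class_of_map G a xX)|exact: (class_of_map F a yY)|].
have [c [c0 cE]] := hval_ihom_map p a.
move=> b e w ew; rewrite !cE.
(* If c is not 0, small parameters for alpha are small for alpha'. *)
have [->|/c0 le_alpha] := eqVneq c 0; first by rewrite !scale0r.
congr (_ *: _); apply: xy.
rewrite -prev_map_d -chm_comm.
case: ew => [[-> ->]|[s [le_sb [z [q [ts zq -> ->]]]]]]; first by left; rewrite !linear0.
right; exists s, le_sb, (prev_map F n s z), (G 0%N s q); split.
- exact: small_alpha ts.
- by rewrite /lifts_cycle FG; exact: prev_represents_map.
- exact: pmor_natural.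
- exact: pmor_natural.
Qed.

End Naturality.

(** * The splitting *)

Section Splitting.
Variables (R : realType) (k : fieldType) (p : {posnum R}) (alpha : {nonneg R}).
Local Notation Rp := {nonneg R}.
Local Notation A := (interval k alpha : pmod k Rp).
Variables (K : chain_complex k Rp) (n : nat).
Hypothesis Kinj : forall m, pm_inj (K m).
Local Notation hclass := (@represents _ _ _ _ (cycles K n) (im_subpmod (ch_d K n)) _).

Lemma below_le (N : pmod k Rp) t t' b (z : N b) : (t <= t')%O ->
  below p alpha t' z -> below p alpha t z.
Proof.
move=> le_t /belowP[->|[a [le_ab [z' [ta ->]]]]]; apply/belowP; [by left|right].
exists a, le_ab, z'; split; first exact: small_le le_t (lexx a) ta.
exact: erefl.
Qed.

Section Colimit.
Variables (M : pmod k Rp) (W : lmodType k) (i : forall a, {linear M a -> W}).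
Hypothesis iE : forall a b (le_ab : (a <= b)%O) m, i b (pm_map M le_ab m) = i a m.

Lemma colimit_sub_linear (S : forall a, M a -> Prop) :
  (forall a, S a 0) -> (forall a c m m', S a m -> S a m' -> S a (c *: m + m')) ->
  (forall a b (le_ab : (a <= b)%O) m, S a m -> S b (pm_map M le_ab m)) ->
  exists T : submod W, forall w, T w <-> exists a m, S a m /\ i a m = w.
Proof.
move=> S0 Slin Sst; pose T w := exists a m, S a m /\ i a m = w.
have T0 : T 0 by exists 0%:nng, 0; rewrite linear0.
have Tlin c w w' : T w -> T w' -> T (c *: w + w').
  move=> [a [m [Sm <-]]] [b [m' [Sm' <-]]].
  have le_a : (a <= Order.max a b)%O by rewrite le_max lexx.
  have le_b : (b <= Order.max a b)%O by rewrite le_max lexx orbT.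
  exists (Order.max a b), (c *: pm_map M le_a m + pm_map M le_b m').
  by rewrite linearP !iE; split=> //; apply: Slin; exact: Sst.
have TD w w' : T w -> T w' -> T (w + w').
  by move=> Tw Tw'; rewrite -[w]scale1r; exact: Tlin.
have TZ c w : T w -> T (c *: w).
  by move=> Tw; rewrite -[_ *: _]addr0; exact: Tlin.
by exists (Submod T0 TD TZ).
Qed.

End Colimit.

(** Compose a functional on the cycles with projections [r J] of the colimit onto
    the cycles, each of which respects the small parts for the finitely many
    parameters in J, and take the limit L over J.  For c small with respect to t
    the value is 0 as soon as t is in J, and on cycles it is constant in J. *)
Lemma evaluation_split : split_epi (evaluation p alpha K n).
Proof.
have [o _] : exists o : Rp, True by exists 0%:nng.
have [W [i [iE i0]]] := colimit_exists (K n) o.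
have [|a c m m' m0 m0'|a b le_ab m m0|Z ZE] :=
  @colimit_sub_linear _ _ _ iE (fun a m => prev_d K n a m = 0).
- by move=> a; exact: linear0.
- by rewrite linearP m0 m0' scaler0 addr0.
- by rewrite pmor_natural m0 linear0.
have /choice[D DE] : forall t, exists D : submod W, forall w, D w <->
    exists a m, below p alpha t m /\ i a m = w.
  move=> t; apply: colimit_sub_linear => //; first by left.
    by move=> *; exact: below_lin.
  by move=> *; exact: pushed_stable.
have D_chain s t : (forall v, D s v -> D t v) \/ (forall v, D t v -> D s v).
  have [st|/ltW ts] := leP s t; [right|left] => v /DE[a [m [bm <-]]].
    by apply/DE; exists a, m; split; first exact: below_le st bm.
  by apply/DE; exists a, m; split; first exact: below_le ts bm.
have /choice[r rP] := flag_proj Z D_chain.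
have [L [L_lin L_lim]] := limit_functional k Rp.
(* e picks a homology class for each cycle of the colimit, hence the value hz of
   a functional there; injectivity makes it independent of the choice. *)
have /choice[e eP] : forall w, exists e : {a & homology K n a}, Z w ->
    exists z, hclass z (projT2 e) /\ i _ z = w.
  move=> w; have [/ZE[a [z [/cyclesE zc zw]]]|nZ] := pselect (Z w).
    have [eta zeta] := @represents_of _ _ _ _ _ (im_subpmod (ch_d K n)) _ _ zc.
    by exists (existT _ a eta) => _; exists z.
  by exists (existT (fun a => homology K n a) o (0 : homology K n o)) => /nZ.
pose hz t (h : ihom_lp p (homology K n) A t) w : k^o := hval h (projT2 (e w)).
have hzE t h a z eta : hclass z eta -> hz t h (i a z) = hval h eta.
  move=> zeta; have [|z' [z'eta' zz']] := eP (i a z).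
    by apply/ZE; exists a, z; split=> //; apply/cyclesE; exact: represents_in zeta.
  rewrite /hz; move: (projT1 _) (projT2 _) z' z'eta' zz' => b eta' z' z'eta' zz'.
  have le_a : (a <= Order.max a b)%O by rewrite le_max lexx.
  have le_b : (b <= Order.max a b)%O by rewrite le_max lexx orbT.
  rewrite -(hval_map h le_a) -(hval_map h le_b); congr (hval h _).
  have : i _ (pm_map (K n) le_a z - pm_map (K n) le_b z') = 0.
    by rewrite linearB !iE zz' subrr.
  move=> /i0[c [le_c /Kinj/eqP]]; rewrite subr_eq0 => /eqP zz.
  apply: (single_valuedP (represents_lin _ _ _) (@represents_sv _ _ _ _ _ _ _)).
    exact: represents_stable z'eta'.
  by rewrite -zz; exact: represents_stable.
have ZP w : Z w -> exists a z eta, i a z = w /\ hclass z eta.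
  move=> /ZE[a [z [/cyclesE zc zw]]]; exists a, z.
  have [eta zeta] := @represents_of _ _ _ _ _ (im_subpmod (ch_d K n)) _ _ zc.
  by exists eta.
have hz_lin t h c w w' : Z w -> Z w' ->
    hz t h (c *: w + w') = c *: hz t h w + hz t h w'.
  move=> /ZP[a [z [eta [<- zeta]]]] /ZP[b [z' [eta' [<- zeta']]]].
  have le_a : (a <= Order.max a b)%O by rewrite le_max lexx.
  have le_b : (b <= Order.max a b)%O by rewrite le_max lexx orbT.
  rewrite (hzE _ _ _ _ _ zeta) (hzE _ _ _ _ _ zeta').
  rewrite -(hval_map h le_a) -(hval_map h le_b)
    -hval_linearr -(iE _ _ le_a) -(iE _ _ le_b).
  rewrite -linearP; apply: hzE; apply: (represents_lin _ _ _).2;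
    exact: represents_stable.
pose S t (h : ihom_lp p (homology K n) A t) w := L (fun J => hz t h (r J w)).
have S_lin t h c w w' : S t h (c *: w + w') = c *: S t h w + S t h w'.
  rewrite -L_lin; congr L; apply: funext => J; rewrite linearP.
  by apply: hz_lin; have [] := rP J.
have S_linl t h h' c w : S t (c *: h + h') w = c *: S t h w + S t h' w.
  pose f h := (fun J : seq Rp => hz t h (r J w)) : seq Rp -> k^o.
  have fE : f (c *: h + h') = c *: f h + f h'.
    apply: funext => J; exact: (hval_linearl c h h' (projT2 (e (r J w)))).
  by rewrite /S -/(f h) -/(f h') -L_lin -fE.
have S_cycle t h a z eta : hclass z eta -> S t h (i a z) = hval h eta.
  move=> zeta; apply: (L_lim _ _ [::]) => J _; have [_ r_id _] := rP J.
  rewrite r_id; first exact: hzE.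
  by apply/ZE; exists a, z; split=> //; apply/cyclesE; exact: represents_in zeta.
have S_small t h a m : small p alpha t a -> S t h (i a m) = 0.
  move=> ta; apply: (L_lim _ _ [:: t]) => J tJ; have [rZ _ rD] := rP J.
  have /DE[b [z [bz zr]]] : D t (r J (i a m)).
    apply: rD; first by apply: tJ; rewrite inE.
    apply/DE; exists a, m; split=> //; exact: pushed_small.
  have /ZE[b' [z' [z'0 z'r]]] := rZ (i a m).
  have z0 : prev_d K n b z = 0.
    have le_b : (b <= Order.max b b')%O by rewrite le_max lexx.
    have le_b' : (b' <= Order.max b b')%O by rewrite le_max lexx orbT.
    have : i _ (pm_map (K n) le_b z - pm_map (K n) le_b' z') = 0.
      by rewrite linearB !iE zr z'r subrr.
    move=> /i0[c [le_c /Kinj/eqP]]; rewrite subr_eq0 => /eqP zz.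
    apply: (prev_inj Kinj (le_st := le_b)).
    by rewrite -pmor_natural zz pmor_natural z'0 linear0.
  rewrite -zr; case/belowP: bz z0 => [->|[b1 [le_b [z1 [tb ->]]]]].
    have := hzE t h b 0 0 (represents_lin _ _ _).1.
    by rewrite hval0r.
  rewrite pmor_natural => /(prev_inj Kinj)/cyclesE z1c; rewrite iE.
  have [eta zeta] := @represents_of _ _ _ _ _ (im_subpmod (ch_d K n)) _ _ z1c.
  by rewrite (hzE _ _ _ _ _ zeta) hval_small.
have hval_S t h : exists x : ihom_lp p (K n) A t, forall b c, hval x c = S t h (i b c).
  have phi_lin b : linear (fun c => S t h (i b c)).
    by move=> c m m'; rewrite linearP; exact: S_lin.
  have [a b le_ab m|a m|x xE] :=
    @hval_exists _ _ p alpha (K n) t (fun b => mk_linear (phi_lin b)).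
  - by rewrite /= /linear_fun iE.
  - exact: S_small.
  - by exists x.
pose G t (h : ihom_lp p (homology K n) A t)
    (X : cohomology (ihom_lp_complex p K A) n t) :=
  exists2 x, class_of x X & forall b c, hval x c = S t h (i b c).
have G_lin t : linear_rel (@G t).
  split=> [|c h X h' X' [x xX xE] [x' xX' xE']].
    exists 0; first exact: (class_of_lin _ _ _ _ _).1.
    move=> b c; rewrite hval0l; apply/esym/(L_lim _ _ [::]) => J _.
    exact: hval0l.
  exists (c *: x + x'); first exact: (class_of_lin _ _ _ _ _).2.
  by move=> b m; rewrite hval_linearl xE xE' S_linl.
have G_sv t : single_valued (@G t).
  move=> X [x xX xE]; suff x0 : x = 0 by move: xX; rewrite x0; exact: class_of_sv.
  apply: hval_inj => b c; rewrite xE hval0l; apply: (L_lim _ _ [::]) => J _.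
  exact: hval0l.
have G_ex t h : exists X, G t h X.
  have [x xE] := hval_S t h.
  have [b c|X xX] := @class_of_cocycle_ex _ _ p alpha K n t x; last by exists X, x.
  have bd : im_subpmod (ch_d K n) b (ch_d K n b c) by exists c.
  have [|eta deta] := @represents_of _ _ _ _ (cycles K n)
    (im_subpmod (ch_d K n)) b (ch_d K n b c).
    by apply/cyclesE; exact: prev_dd.
  rewrite xE (S_cycle _ _ _ _ _ deta).
  by have -> : eta = 0 by [apply/(represents0 deta)]; exact: hval0r.
have G_st : stable_rel G.
  move=> s t le_st h X [x xX xE].
  exists (pm_map (ihom_lp p (K n) A) le_st x); first exact: class_of_stable.
  move=> b c; rewrite hval_restrict xE; apply: (f_equal L); apply: funext => J.
  exact: esym (hval_restrict le_st h (projT2 (e (r J (i b c))))).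
have [s sG] := pmor_of_rel G_lin G_sv G_ex G_st.
exists s => t h; have [x xX xE] := sG t h.
apply: hval_inj => b eta; have [z zeta] := represents_ex eta.
by rewrite (evaluationE xX zeta) xE; exact: S_cycle.
Qed.

End Splitting.

(** * Borel-Moore homology *)

Section BorelMooreDual.
Variables (R : realType) (k : fieldType) (p : {posnum R}).
Variable D : bounded_filtration R.
Local Notation Rp := {nonneg R}.
Local Notation f := (bf_filt D).
Local Notation alpha := (bf_alpha D).
Local Notation X := (bf_complex D).
Local Notation A := (bf_module k D).
Local Notation C := (bf_chains k D).
Local Notation g := (alpha_filtration p D).

Lemma bf_chains_inj n : pm_inj (C n).
Proof. by move=> s t le_st x /(congr1 val) /= x0; apply: val_inj. Qed.

(** Both sides say f(s)^p + t^p < alpha^p: the parameters of simplices that are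
    small for t are those of T_t. *)
Lemma small_cosublevel t s : small p alpha t (f s) = cosublevel g t s.
Proof.
have ltX (a b : R) : 0 <= a -> 0 <= b ->
    ((a `^ p%:num) < (b `^ p%:num)) = (a < b).
  move=> a0 b0; rewrite ltNge [RHS]ltNge; congr (~~ _); apply/idP/idP => ab.
    rewrite leNgt; apply: contraL ab => ab; rewrite -ltNge.
    by rewrite gt0_ltr_powR.
  by rewrite ge0_ler_powR.
have rootK (a : R) : 0 <= a -> (a `^ (p%:num)^-1) `^ p%:num = a.
  by move=> a0; rewrite -powRrM mulVf // powRr1.
have fa : (f s)%:num `^ p%:num <= alpha%:num `^ p%:num.
  by apply: ge0_ler_powR; rewrite ?nnegrE //; exact/ltW/bf_lt.
rewrite smallE -[in LHS]ltNge -[RHS]/(~~ (_ `^ _ <= t%:num)) -ltNge.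
rewrite -[LHS]/(_ `^ _ < alpha%:num) -[LHS]ltX ?powR_ge0 // -[RHS]ltX ?powR_ge0 //.
rewrite !rootK ?subr_ge0 ?addr_ge0 ?powR_ge0 //.
by rewrite ltrBrDr addrC.
Qed.

(** All values of f are below alpha, so at alpha the filtered complex is the
    complex of all chains of X: it serves as the colimit. *)
Lemma at_topP n (c : chains X k n) : c \in submod_pred (filt_submod k f n alpha).
Proof.
by apply/submod_predP => s /negP[]; exact/ltW/bf_lt.
Qed.

Definition at_top n (c : chains X k n) : C n alpha := SubmodType (at_topP c).

Section Fixed.
Variables (n : nat) (t : Rp).

Local Notation relC := (subcomplex_chains k (cosublevel g t)).

Lemma below_rel_chains b (c : C n b) :
  below p alpha t c -> relC n (\val c).
Proof.
case/belowP => [->|[a [le_ab [c' [ta ->]]]]]; first exact: submod0.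
move=> s sT; have /submod_predP c'f := valP c'; apply: c'f.
apply: contra sT => le_sa; rewrite -small_cosublevel.
exact: small_le (lexx t) le_sa ta.
Qed.

Section Values.
Variable x : ihom_lp p (C n) A t.

Lemma hval_top b (c : C n b) : hval x (at_top (\val c)) = hval x c.
Proof.
have le_b : (b <= Order.max b alpha)%O by rewrite le_max lexx.
have le_a : (alpha <= Order.max b alpha)%O by rewrite le_max lexx orbT.
rewrite -(hval_map x le_b) -(hval_map x le_a); congr (hval x _).
exact: val_inj.
Qed.

Lemma hval_top_linear : linear (fun c : chains X k n => hval x (at_top c)).
Proof.
by move=> a c c'; rewrite -hval_linearr; congr (hval x _); exact: val_inj.
Qed.

(** A chain of T_t is a combination of simplices, each of which is present at a
    small parameter. *)
Lemma hval_top_rel c : relC n c -> hval x (at_top c) = 0.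
Proof.
move=> cT; pose v := mk_linear hval_top_linear; rewrite -[LHS]/(v c).
rewrite [c]monalgE raddf_sum big1 // => s _.
have [sT|/cT ->] := boolP (cosublevel g t (sval s)); last first.
  have -> : << (0 : k) *g s >> = 0 by apply/malgP => u; rewrite mcoeffU mcoeff0 mul0rn.
  exact: linear0.
have sf : << c@_s *g s >> \in submod_pred (filt_submod k f n (f (sval s))).
  apply/submod_predP => s' /=; rewrite mcoeffU; case: eqP => [-> /negP[]|//].
  exact: lexx.
rewrite -[LHS]/(hval x (at_top (\val (SubmodType sf : C n (f (sval s)))))).
by rewrite hval_top hval_small // small_cosublevel.
Qed.

End Values.

Definition rel_represents (c : chains X k n) (eta : BM_homology k g n t) : Prop :=
  @represents _ _ _ (rel_complex k g n) (cycles (rel_complex k g) n)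
    (im_subpmod (ch_d (rel_complex k g) n)) t (quot_proj _ c) eta.

Lemma rel_represents_lin : linear_rel rel_represents.
Proof.
split=> [|a c eta c' eta' cE cE']; rewrite /rel_represents.
  by rewrite linear0; exact: (represents_lin _ _ _).1.
by rewrite linearP; exact: (represents_lin _ _ _).2.
Qed.

Lemma rel_represents_ex eta : exists c, rel_represents c eta.
Proof. by have [z] := represents_ex eta; elim/quot_ind: z => c; exists c. Qed.

Lemma rel_dE m (e : chains X k m.+1) :
  ch_d (rel_complex k g) m t (quot_proj _ e) = quot_proj _ (boundary X k m e).
Proof. exact: quot_mapE. Qed.

Lemma rel_represents0 c : rel_represents c 0 -> exists e, relC n (c - boundary X k n e).
Proof.
move=> /represents0[/(_ erefl)[e de] _]; elim/quot_ind: e de => e de.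
have /esym/quot_proj_eq eT := etrans (esym (rel_dE e)) de.
by exists e.
Qed.

Lemma rel_represents_null c : relC n c -> rel_represents c 0.
Proof.
move=> /quot_proj_eq0 cT; rewrite /rel_represents.
by rewrite (_ : quot_proj _ c = 0) //; exact: (represents_lin _ _ _).1.
Qed.

Lemma rel_represents_sv : single_valued rel_represents.
Proof. by move=> eta; rewrite /rel_represents linear0; exact: represents_sv. Qed.

Lemma rel_represents_boundary e : rel_represents (boundary X k n e) 0.
Proof.
pose e' : rel_complex k g n.+1 t := quot_proj _ e.
have [|eta etaE] := @represents_of _ _ _ _ (cycles (rel_complex k g) n)
  (im_subpmod (ch_d (rel_complex k g) n)) t (ch_d (rel_complex k g) n t e').
  by apply/cyclesE; exact: prev_dd.
have eta0 : eta = 0 by apply/(represents0 etaE); exists e'.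
by rewrite /rel_represents -rel_dE -eta0.
Qed.

End Fixed.

Lemma rel_represents_cycle n t b (c : C n b) : below p alpha t (prev_d C n b c) ->
  exists eta : BM_homology k g n t, rel_represents (\val c) eta.
Proof.
move=> bc; have [|eta etaE] := @represents_of _ _ _ _ (cycles (rel_complex k g) n)
  (im_subpmod (ch_d (rel_complex k g) n)) t (quot_proj _ (\val c)); last by exists eta.
apply/cyclesE; case: n c bc => [|m] c bc; first exact: zero_pmod_eq0.
apply: etrans (rel_dE _ _) _; apply/quot_proj_eq0.
exact: (below_rel_chains bc).
Qed.

Lemma rel_represents_hval n t (e : ihom_lp p (prev C n) A t) c eta :
  @rel_represents n t c eta -> hval e (prev_d C n alpha (at_top c)) = 0.
Proof.
case: n e c eta => [|m] e c eta cE; first by rewrite [prev_d _ _ _ _]zero_pmod_eq0 hval0r.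
have /cyclesE dc := represents_in cE.
have /quot_proj_eq0 cT := etrans (esym (rel_dE _ _)) dc.
apply: etrans (hval_top_rel e cT); congr (hval e _); exact: val_inj.
Qed.

Lemma Hom_of_linear (U V : lmodType k) (v : {linear U -> V}) :
  exists phi : Hom U V, forall u, Hom_app phi u = v u.
Proof.
have vP : (v : U -> V) \in submod_pred (linear_submod U V).
  by apply/submod_predP; exact: linearP.
by exists (SubmodType vP).
Qed.

Section Duality.
Variable n : nat.
Local Notation HomC := (ihom_lp_complex p C A).
Local Notation BM := (BM_homology k g n).

Definition pairs_with t (Y : cohomology HomC n t) (phi : dual_pmod BM t) : Prop :=
  exists2 x, class_of x Y &
    forall c eta, @rel_represents n t c eta -> Hom_app phi eta = hval x (at_top c).

Lemma pairs_with_lin t : linear_rel (@pairs_with t).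
Proof.
split=> [|a Y phi Y' phi' [x xY xphi] [x' xY' xphi']].
  by exists 0 => [|c eta _]; [exact: (class_of_lin _ _ _ _ _).1|rewrite hval0l].
exists (a *: x + x') => [|c eta cE]; first exact: (class_of_lin _ _ _ _ _).2.
by rewrite hval_linearl Hom_app_lin (xphi _ _ cE) (xphi' _ _ cE).
Qed.

Lemma pairs_with_sv t : single_valued (@pairs_with t).
Proof.
move=> phi [x /class_of0[/(_ erefl)[e xE] _] xphi].
apply: val_inj; apply: funext => eta.
have [c cE] := rel_represents_ex eta.
by apply: etrans (xphi _ _ cE) _; rewrite xE (rel_represents_hval e cE).
Qed.

(** The class is zero as soon as the values on relative cycles are, since these
    are the chains whose boundary comes from small parameters. *)
Lemma pairs_with_inj t Y : @pairs_with t Y 0 -> Y = 0.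
Proof.
move=> [x xY x0]; apply/(class_of0 xY); apply: hom_factor => b c bc.
have [eta cE] := rel_represents_cycle bc.
by rewrite -hval_top -(x0 _ _ cE).
Qed.

Lemma pairs_with_ex t Y : exists phi, @pairs_with t Y phi.
Proof.
have [x xY] := class_of_ex Y.
pose G (eta : BM t) (v : k^o) :=
  exists2 c, @rel_represents n t c eta & v = hval x (at_top c).
have [| |v vG] := @extend_linear_rel k (BM t) k^o G.
- split=> [|a eta _ eta' _ [c cE ->] [c' cE' ->]].
    exists 0; first exact: (rel_represents_lin _ _).1.
    exact: esym (linear0 (mk_linear (hval_top_linear x))).
  exists (a *: c + c'); first exact: (rel_represents_lin _ _).2.
  exact: esym (hval_top_linear x a c c').
- move=> _ [c /rel_represents0[e ce] ->].
  rewrite -[c](subrK (boundary X k n e)).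
  have /= := hval_top_linear x 1 (c - boundary X k n e) (boundary X k n e).
  rewrite !scale1r => ->; rewrite (hval_top_rel x ce) add0r.
  apply: etrans (class_of_cocycle (at_top e) xY); congr (hval x _).
  exact: val_inj.
have [phi phiE] := Hom_of_linear v.
by exists phi, x => // c eta cE; rewrite phiE; apply: vG; exists c.
Qed.

(** A functional on relative homology is a functional on relative cycles; any
    extension to all chains is a cocycle, since boundaries represent 0. *)
Lemma pairs_with_surj t phi : exists Y, @pairs_with t Y phi.
Proof.
pose G (c : chains X k n) (v : k^o) :=
  exists2 eta, @rel_represents n t c eta & v = Hom_app phi eta.
have G0 c : @rel_represents n t c 0 -> G c 0.
  by move=> c0; exists 0 => //; rewrite (linear0 (Hom_app phi)).
have [| |v vG] := @extend_linear_rel k (chains X k n) k^o G.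
- split=> [|a c _ c' _ [eta cE ->] [eta' cE' ->]].
    by apply: G0; exact: (rel_represents_lin _ _).1.
  exists (a *: eta + eta'); first exact: (rel_represents_lin _ _).2.
  exact: esym (linearP (Hom_app phi) a eta eta').
- by move=> _ [eta /rel_represents_sv -> ->]; exact: (linear0 (Hom_app phi)).
have v_lin b : linear (fun c : C n b => v (\val c)) by move=> a c c'; rewrite !linearP.
have [a b le_ab c|b c tb|x xE] :=
    @hval_exists _ _ p alpha (C n) t (fun b => mk_linear (v_lin b)).
- by [].
- apply: vG; apply: G0; apply: rel_represents_null; apply: below_rel_chains.
  exact: (@pushed_small _ _ _ _ _ _ (fun _ z w => z = w)).
have [b e|Y xY] := @class_of_cocycle_ex _ _ p alpha C n t x.
  rewrite xE; apply: vG; apply: G0; exact: (rel_represents_boundary t (\val e)).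
by exists Y, x => // c eta cE; rewrite xE; apply/esym/vG; exists eta.
Qed.

Lemma pairs_with_stable : stable_rel pairs_with.
Proof.
move=> s t le_st Y phi [x xY xphi].
exists (pm_map (ihom_lp p (C n) A) le_st x); first exact: class_of_stable.
move=> c eta cE; rewrite hval_restrict.
apply: etrans _ (xphi c (pm_map BM (le_st : (t : Rp^d) <= s)%O eta) _); first by [].
pose le_ts := le_st : ((t : Rp^d) <= s)%O.
pose pr u : rel_complex k g n u := quot_proj _ c.
have prE : pm_map (rel_complex k g n) le_ts (pr t) = pr s by exact: quot_mapE.
by rewrite /rel_represents -/(pr s) -prE; exact: represents_stable cE.
Qed.

Lemma cohomology_BM_dual : pmod_iso (cohomology HomC n) (dual_pmod BM).
Proof.
exact: iso_of_rel pairs_with_lin pairs_with_sv pairs_with_inj pairs_with_ex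
  pairs_with_surj pairs_with_stable.
Qed.

End Duality.
End BorelMooreDual.

(** * The theorem *)

Theorem theorem5p11 (R : realType) (k : fieldType) (p : {posnum R}) :
  (forall (D : bounded_filtration R) (n : nat),
     pmod_iso (cohomology (ihom_lp_complex p (bf_chains k D) (bf_module k D)) n)
       (dual_pmod (BM_homology k (alpha_filtration p D) n)))
  /\
  exists (iota : forall (D : bounded_filtration R) (n : nat)
              (Q : projective_resolution (homology_pred (bf_chains k D) n)),
            pmor (Ext_lp p 1 Q (bf_module k D))
              (cohomology (ihom_lp_complex p (bf_chains k D) (bf_module k D)) n))
         (pi : forall (D : bounded_filtration R) (n : nat),
            pmor (cohomology (ihom_lp_complex p (bf_chains k D) (bf_module k D)) n)
              (ihom_lp p (homology (bf_chains k D) n) (bf_module k D))),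
    [/\ forall D n Q, short_exact (iota D n Q) (pi D n) /\ split_epi (pi D n),
        forall (D D' : bounded_filtration R) (n : nat)
          (F : chain_map (bf_chains k D) (bf_chains k D'))
          (a : pmor (bf_module k D') (bf_module k D)) t x,
          pi D n t (cohomology_map (ihom_lp_complex_map p F a) n t x) =
          ihom_lp_map p (homology_map F n) a t (pi D' n t x)
      & forall (D D' : bounded_filtration R) (n : nat)
          (F : chain_map (bf_chains k D) (bf_chains k D'))
          (a : pmor (bf_module k D') (bf_module k D))
          (Q : projective_resolution (homology_pred (bf_chains k D) n))
          (Q' : projective_resolution (homology_pred (bf_chains k D') n))
          (G : chain_map Q Q'),
          lifts_to_resolutions (homology_pred_map F n) G ->
          forall t x,
          iota D n Q t (cohomology_map (ihom_lp_complex_map p G a) 1 t x) =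
          cohomology_map (ihom_lp_complex_map p F a) n t (iota D' n Q' t x)].
Proof.
split=> [D n|]; first exact: cohomology_BM_dual.
exists (fun D n Q => connecting p (bf_alpha D) (@bf_chains_inj R k D) Q).
exists (fun D n => evaluation p (bf_alpha D) (bf_chains k D) n).
split=> [D n Q|D D' n F a t x|D D' n F a Q Q' G FG t x].
- have split_eval := evaluation_split p (bf_alpha D) n (@bf_chains_inj R k D).
  split; last exact: split_eval.
  split=> [t|t y|t z]; [exact: connecting_inj|exact: connecting_exact|].
  by have [s sK] := split_eval; exists (s t z).
- exact: evaluation_natural.
- exact: connecting_natural FG t x.
Qed.
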